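(* Let $0<\alpha<n$ and let $f\in L^2(\mathbb R^n)$ be log-concave. Then \[ \frac{\Gamma(n+1)^{\alpha/n}}{\Gamma(\alpha)}\,|\mathrm{H}_\alpha f|^{\alpha/n} \geq \|f\|_2^{2-\frac{2\alpha}n} \|f\|_1^{\frac{2\alpha}n} \geq \Vert f\Vert_{\frac{2n}{n+\alpha}}^2.\] There is equality in the first inequality if $f(x)=a\,e^{-\Vert x - x_0\Vert_\Delta}$ for $x\in\mathbb R^n$, with $a\ge 0$, $x_0\in\mathbb R^n$, and $\Delta$ an $n$-dimensional simplex having a vertex at the origin.
   Context: A function $f:\mathbb R^n\to[0,\infty)$ is log-concave if $\log f$ is concave with values in $[-\infty,\infty)$. For a star-shaped set $K$ (closed, with $[0,x]\subset K$ for all $x\in K$) its radial function is $\rho_K(x)=\sup\{\lambda\ge0:\lambda x\in K\}$ and its gauge is $\Vert x\Vert_K=\inf\{\lambda>0: x\in\lambda K\}$. For measurable $f:\mathbb R^n\to[0,\infty)$ and $\alpha>0$, $\mathrm{H}_\alpha f$ denotes the star-shaped set with radial function given for $\xi\in\mathbb S^{n-1}$ by $\rho_{\mathrm{H}_\alpha f}(\xi)^\alpha=\int_0^\infty t^{\alpha-1}\int_{\mathbb R^n} f(x)f(x+t\xi)\,dx\,dt$, and $|\mathrm{H}_\alpha f|=\frac1n\int_{\mathbb S^{n-1}}\rho_{\mathrm{H}_\alpha f}(\xi)^n\,d\xi$ is its volume. *)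

(* Defs.v *)
From HB Require Import structures.
From mathcomp Require Import all_boot all_order all_algebra.
From mathcomp Require Import all_classical all_reals all_analysis.
Set Implicit Arguments. Unset Strict Implicit. Unset Printing Implicit Defensive.
Import Order.TTheory GRing.Theory Num.Theory.
Local Open Scope classical_set_scope.
Local Open Scope ring_scope.

Section Defs.
Variable R : realType.
Local Notation leb := (@lebesgue_measure R).

(* Lebesgue integral over R^n = 'rV[R]_n, written as the iterated integral
   over the coordinates (for nonnegative functions this is Tonelli). *)
Fixpoint intRn (n : nat) : ('rV[R]_n -> \bar R) -> \bar R :=
  match n return ('rV[R]_n -> \bar R) -> \bar R with
  | 0 => fun f => f 0
  | n'.+1 => fun f =>
      (\int[leb]_x intRn (fun y : 'rV[R]_n' => f (row_mx (\row_(j < 1) x) y)))%E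
  end.

Definition enorm (n : nat) (x : 'rV[R]_n) : R :=
  Num.sqrt (\sum_(i < n) x ord0 i ^+ 2).

Definition Lpn (n : nat) (f : 'rV[R]_n -> R) (p : R) : \bar R :=
  poweR (intRn (fun x => (powR `|f x| p)%:E)) p^-1.

Definition lnE (x : R) : \bar R := if 0 < x then (ln x)%:E else -oo%E.

Definition log_concave (n : nat) (f : 'rV[R]_n -> R) : Prop :=
  (forall x, 0 <= f x) /\
  forall (x y : 'rV[R]_n) (t : R), 0 <= t <= 1 ->
    ((1 - t)%:E * lnE (f x) + t%:E * lnE (f y) <= lnE (f ((1 - t) *: x + t *: y)%R))%E.

Definition rhoH_pow (n : nat) (alpha : R) (f : 'rV[R]_n -> R) (xi : 'rV[R]_n) : \bar R :=
  (\int[leb]_(t in `]0%R, +oo[)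
     ((powR t (alpha - 1))%:E * intRn (fun x => (f x * f (x + t *: xi))%:E)))%E.

Definition Hset (n : nat) (alpha : R) (f : 'rV[R]_n -> R) : set 'rV[R]_n :=
  [set x | x = 0 \/ ((powR (enorm x) alpha)%:E <= rhoH_pow alpha f ((enorm x)^-1 *: x))%E].

Definition volH (n : nat) (alpha : R) (f : 'rV[R]_n -> R) : \bar R :=
  intRn (fun x => (\1_(Hset alpha f) x)%:E).

Definition Gamma (s : R) : R :=
  fine (\int[leb]_(t in `]0%R, +oo[) (powR t (s - 1) * expR (- t))%:E)%E.

(* n-simplex conv{0, rows of V} *)
Definition simplex (n : nat) (V : 'M[R]_n) : set 'rV[R]_n :=
  [set y | exists c : 'rV[R]_n,
     (forall i, 0 <= c ord0 i) /\ \sum_(i < n) c ord0 i <= 1 /\ y = c *m V].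

(* gauge ||x||_K = inf {l > 0 : x in l K}, +oo if empty *)
Definition gauge (n : nat) (K : set 'rV[R]_n) (x : 'rV[R]_n) : \bar R :=
  ereal_inf [set l%:E | l in [set l : R | 0 < l /\ [set l *: y | y in K] x]].

Definition lhs_H (n : nat) (alpha : R) (f : 'rV[R]_n -> R) : \bar R :=
  ((powR (Gamma n.+1%:R) (alpha / n%:R) / Gamma alpha)%:E
     * poweR (volH alpha f) (alpha / n%:R))%E.

Definition mid_H (n : nat) (alpha : R) (f : 'rV[R]_n -> R) : \bar R :=
  (poweR (Lpn f 2) (2 - 2 * alpha / n%:R) * poweR (Lpn f 1) (2 * alpha / n%:R))%E.

Definition rhs_H (n : nat) (alpha : R) (f : 'rV[R]_n -> R) : \bar R :=
  poweR (Lpn f (2 * n%:R / (n%:R + alpha))) 2.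

End Defs.

(* Main.v *)
Require Import Defs.
From HB Require Import structures.
From mathcomp Require Import all_boot all_order all_algebra.
From mathcomp Require Import all_classical all_reals all_analysis.
From mathcomp Require Import measurable_realfun.
From mathcomp Require Import ring lra.
Set Implicit Arguments. Unset Strict Implicit. Unset Printing Implicit Defensive.
Import Order.TTheory GRing.Theory Num.Theory.
Import numFieldNormedType.Exports.
Local Open Scope ring_scope.
Local Open Scope classical_set_scope.

(* Write F(z) = int f(x) f(x + z) dx, so that F(0) = ||f||_2^2 and int F = ||f||_1^2,
   while rho_H(xi)^alpha is the moment int_0^oo t^(alpha - 1) F(t xi) dt. By the
   Prékopa-Leindler inequality F(s z) >= F(0)^(1 - s) F(z)^s, hence along every ray F
   crosses the exponential F(0) exp (- c t) having the same moment of order alpha at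
   most once, and its moment of order n > alpha is at most that of the exponential.
   Integrating over the rays gives int F <= F(0) Gamma(n + 1) |K|, where K is a
   dilate of H_alpha f; this is the first inequality. If f is a translate of
   a exp (- ||x||_Delta), then F is exactly F(0) exp (- psi) with psi a norm, and
   equality holds. The second inequality is Hölder's. As f need not be Borel, it is
   first replaced by its lower semicontinuous envelope. *)

(** * Tonelli and changes of variables for iterated integrals *)

(** The constants come from the model F(0) exp (- c t), whose moment of order p is F(0) Gamma(p)
    c^(-p). Matching the order alpha makes c the gauge of the set K of all x with int_0^oo t^(alpha
    - 1) F(t x) dt >= F(0) Gamma(alpha), so K is H_alpha f dilated by (F(0)
    Gamma(alpha))^(-1/alpha), and |K|^(alpha/n) = |H_alpha f|^(alpha/n) / (F(0) Gamma(alpha)).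
    Raising int F <= F(0) Gamma(n + 1) |K| to the power alpha/n and multiplying by F(0)^(1 -
    alpha/n) then cancels F(0) on the right. Two obstacles shape the proof. Integrals over row
    vectors are iterated and come with no spherical measure, so the comparison on rays is integrated
    against a weight depending on one coordinate. And a log-concave function need not be measurable
    on the boundary of its support, so that for [f] itself little more than monotonicity of the
    iterated integral is available. Simplices give equality because a simplicial cone meets each of
    its translates in a further translate. *)

Section IntegralBasics.
Context {R : realType}.
Local Open Scope ereal_scope.

(** The integral of a nonnegative function is a supremum over the simple functions below it, hence
    monotone on arbitrary functions. This is what lets a non-Borel [f] be compared with its
    envelope. *)
Lemma ge0_le_integral_nomeas d (T : measurableType d)
    (m : {measure set T -> \bar R}) (f g : T -> \bar R) :
  (forall x, 0 <= f x) -> (forall x, f x <= g x) ->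
  \int[m]_x f x <= \int[m]_x g x.
Proof.
move=> f0 fg; rewrite !ge0_integralTE //; last first.
  by move=> x; exact: le_trans (f0 x) (fg x).
apply: ereal_sup_le => _ [h hf <-]; exists h => // x.
exact: le_trans (hf x) (fg x).
Qed.

Let affine_measurable (a b : R) :
  measurable_fun [set: measurableTypeR R]
    (fun x : measurableTypeR R => (a * x + b)%R : measurableTypeR R).
Proof. by apply: measurable_funD => //; apply: measurable_funM. Qed.

Let affine_pushforward (a b : R) : {measure set (measurableTypeR R) -> \bar R} :=
  measure_function_pushforward__canonical__measure_function_Measure
    lebesgue_measure (affine_measurable a b).

(** By uniqueness of Lebesgue measure: the scaled push-forward gives half-open intervals their
    length. *)
Lemma lebesgue_measure_affine (a b : R) (A : set R) : (0 < a)%R ->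
  measurable A ->
  lebesgue_measure A = a%:E * lebesgue_measure ((fun x => a * x + b)%R @^-1` A).
Proof.
move=> a0 mA.
apply: (@lebesgue_measure_unique _
  (mscale (NngNum (ltW a0)) (affine_pushforward a b))) => // _ [[c d]] _ <-.
transitivity (a%:E * lebesgue_measure `]((c - b) / a)%R, ((d - b) / a)%R]%classic); last first.
  congr (_ * lebesgue_measure _).
  apply/seteqP; split => x /=; rewrite !in_itv /= ltr_pdivrMr// ler_pdivlMr//;
  by rewrite ltrBlDr lerBrDr [(x * a)%R]mulrC.
rewrite !lebesgue_measure_itv /= !lte_fin.
rewrite ltr_pM2r ?invr_gt0// ltrD2r; case: ifP => _; last by rewrite mule0.
by rewrite -!EFinB -EFinM; congr EFin; field; exact: lt0r_neq0.
Qed.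

Lemma ge0_integral_affine (a b : R) (f : R -> \bar R) : (0 < a)%R ->
  measurable_fun setT f -> (forall x, 0 <= f x) ->
  \int[lebesgue_measure]_x f (a * x + b)%R = a^-1%:E * \int[lebesgue_measure]_x f x.
Proof.
move=> a0 mf f0.
have := @ge0_integral_pushforward _ _ _ _ R _ (affine_measurable a b)
  lebesgue_measure setT f measurableT mf (fun y _ => f0 y).
rewrite preimage_setT /= => <-.
have -> : \int[lebesgue_measure]_x f x =
    \int[mscale (NngNum (ltW a0)) (affine_pushforward a b)]_x f x.
  by apply: eq_measure_integral => A mA _; exact: (lebesgue_measure_affine b a0 mA).
rewrite ge0_integral_mscale//= muleA -EFinM mulVf ?mul1e//.
exact: lt0r_neq0.
Qed.

End IntegralBasics.

(* [Bor f] replaces measurability for a product sigma-algebra on ['rV_n]: [f] is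
   measurable along every map all of whose coordinates are measurable. The
   variant [Bor_param] is joint measurability in a parameter and a vector. *)
Section Bor.
Context {R : realType}.
Local Open Scope ereal_scope.
Local Notation mu := (@lebesgue_measure R).

Definition coord_measurable d (T : measurableType d) n (u : T -> 'rV[R]_n) :=
  forall i, measurable_fun setT (fun t => u t ord0 i).

Definition Bor n (f : 'rV[R]_n -> \bar R) :=
  forall d (T : measurableType d) (u : T -> 'rV[R]_n),
    coord_measurable u -> measurable_fun setT (fun t => f (u t)).

Definition Bor_param d (S : measurableType d) n (f : S -> 'rV[R]_n -> \bar R) :=
  forall d' (T : measurableType d') (s : T -> S) (u : T -> 'rV[R]_n),
    measurable_fun setT s -> coord_measurable u ->
    measurable_fun setT (fun t => f (s t) (u t)).

Definition Bor2 m n (f : 'rV[R]_m -> 'rV[R]_n -> \bar R) :=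
  forall d (T : measurableType d) (u : T -> 'rV[R]_m) (v : T -> 'rV[R]_n),
    coord_measurable u -> coord_measurable v ->
    measurable_fun setT (fun t => f (u t) (v t)).

(** Written exactly as in the unfolding of [intRn], so that [intRnS] holds by conversion. *)
Definition cons_rV n (x : R) (y : 'rV[R]_n) : 'rV[R]_n.+1 :=
  row_mx (\row_(j < 1) x) y.

Lemma cons_rV0 n x (y : 'rV[R]_n) : cons_rV x y ord0 ord0 = x.
Proof.
transitivity (row_mx (\row_(j < 1) x) y ord0 (lshift n (ord0 : 'I_1))).
  by congr (fun_of_matrix _ _ _); exact/val_inj.
by rewrite row_mxEl mxE.
Qed.

Lemma cons_rVS n x (y : 'rV[R]_n) (i : 'I_n) :
  cons_rV x y ord0 (lift ord0 i) = y ord0 i.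
Proof.
rewrite -[RHS](row_mxEr (\row_(j < 1) x)).
by congr (fun_of_matrix _ _ _); exact/val_inj.
Qed.

Lemma coord_measurable_cons d (T : measurableType d) n (x : T -> R) (y : T -> 'rV[R]_n) :
  measurable_fun setT x -> coord_measurable y ->
  coord_measurable (fun t => cons_rV (x t) (y t)).
Proof.
move=> mx my i; have [j ->|->] := unliftP ord0 i.
- by under eq_fun do rewrite cons_rVS; exact: my.
- by under eq_fun do rewrite cons_rV0.
Qed.

Lemma intRnS n (f : 'rV[R]_n.+1 -> \bar R) :
  intRn f = \int[mu]_x intRn (fun y => f (cons_rV x y)).
Proof. by []. Qed.

Lemma intRn_ge0 n (f : 'rV[R]_n -> \bar R) : (forall x, 0 <= f x) -> 0 <= intRn f.
Proof.
by elim: n f => [|n IH] f f0 /=; [|apply: integral_ge0 => x _; exact: IH].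
Qed.

Lemma le_intRn n (f g : 'rV[R]_n -> \bar R) :
  (forall x, 0 <= f x) -> (forall x, f x <= g x) -> intRn f <= intRn g.
Proof.
elim: n f g => [|n IH] f g f0 fg /=; first exact: fg.
apply: ge0_le_integral_nomeas => x; first exact: intRn_ge0.
exact: IH.
Qed.

Lemma eq_intRn n (f g : 'rV[R]_n -> \bar R) : f =1 g -> intRn f = intRn g.
Proof. by move=> /funext ->. Qed.

Lemma Bor_paramE d (S : measurableType d) n (f : S -> 'rV[R]_n -> \bar R) s :
  Bor_param f -> Bor (f s).
Proof. by move=> Bf d' T u mu_; exact: Bf. Qed.

Lemma Bor2_param m n (f : 'rV[R]_m -> 'rV[R]_n -> \bar R) d (S : measurableType d)
    (v : S -> 'rV[R]_m) :
  Bor2 f -> coord_measurable v -> Bor_param (fun s => f (v s)).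
Proof.
move=> Bf mv d' T s u ms mu_; apply: Bf => // i.
exact: (measurableT_comp (mv i)).
Qed.

Lemma Bor_param_cons d (S : measurableType d) n (f : S -> 'rV[R]_n.+1 -> \bar R) :
  Bor_param f ->
  Bor_param (fun (sx : S * R) (y : 'rV[R]_n) => f sx.1 (cons_rV sx.2 y)).
Proof.
move=> Bf d' T s u ms mu_; apply: Bf.
- exact: measurableT_comp.
- by apply: coord_measurable_cons => //; exact: measurableT_comp.
Qed.

(** The induction absorbs one coordinate at a time into the parameter space, passing from [S] to
    [S * R]; hence the arbitrary [S]. *)
Lemma measurable_intRn d (S : measurableType d) n (f : S -> 'rV[R]_n -> \bar R) :
  Bor_param f -> (forall s x, 0 <= f s x) ->
  measurable_fun setT (fun s => intRn (f s)).
Proof.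
elim: n d S f => [|n IH] d S f Bf f0 /=.
  by apply: (Bf _ S id (fun=> 0%R)) => // i; exact: measurable_cst.
apply: (@measurable_fun_fubini_tonelli_F _ _ _ _ _ mu
  (fun sx : S * R => intRn (fun y => f sx.1 (cons_rV sx.2 y)))).
  by apply: (IH _ _ (fun sx y => _)) => //; exact: Bor_param_cons.
by move=> sx; exact: intRn_ge0.
Qed.

Lemma Bor_intRn m n (f : 'rV[R]_m -> 'rV[R]_n -> \bar R) :
  Bor2 f ->
  (forall x y, 0 <= f x y) -> Bor (fun x => intRn (f x)).
Proof.
move=> Bf f0 d T u mu_; apply: (measurable_intRn (f := fun t => f (u t))) => //.
exact: Bor2_param.
Qed.

Section Tonelli.
Context d (S : measurableType d) (m : {sigma_finite_measure set S -> \bar R}).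

Lemma Bor_integral n (f : S -> 'rV[R]_n -> \bar R) :
  Bor_param f -> (forall s x, 0 <= f s x) ->
  Bor (fun x => \int[m]_s f s x).
Proof.
move=> Bf f0 d' T u mu_.
apply: (@measurable_fun_fubini_tonelli_F _ _ _ _ _ m
  (fun ts : T * S => f ts.2 (u ts.1))) => //.
apply: Bf => // i; exact: (measurableT_comp (mu_ i)).
Qed.

Lemma intRn_integral n (f : S -> 'rV[R]_n -> \bar R) :
  Bor_param f -> (forall s x, 0 <= f s x) ->
  \int[m]_s intRn (f s) = intRn (fun x => \int[m]_s f s x).
Proof.
elim: n f => [//|n IH] f Bf f0.
rewrite intRnS.
transitivity (\int[mu]_x \int[m]_s intRn (fun y => f s (cons_rV x y))).
  apply: (@fubini_tonelli _ _ _ _ _ m mu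
    (fun sx : S * R => intRn (fun y => f sx.1 (cons_rV sx.2 y)))).
  - by apply: (measurable_intRn (f := fun sx y => _)) => //; exact: Bor_param_cons.
  - by move=> sx; exact: intRn_ge0.
apply: eq_integral => x _ /=; apply: IH => //.
by move=> d' T s u ms mu_; apply: Bf => //; exact: coord_measurable_cons.
Qed.

End Tonelli.

Lemma exchange_intRn m n (f : 'rV[R]_m -> 'rV[R]_n -> \bar R) :
  Bor2 f ->
  (forall x y, 0 <= f x y) ->
  intRn (fun x => intRn (f x)) = intRn (fun y => intRn (f ^~ y)).
Proof.
elim: m f => [|m IH] f Bf f0 //.
rewrite intRnS; under eq_integral => x _.
  rewrite (IH (fun x' y => f (cons_rV x x') y))//; last first.
    move=> d T u v mu_ mv; apply: Bf => //; exact: coord_measurable_cons.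
  over.
apply: (@intRn_integral _ _ mu _ (fun x y => intRn (fun x' => f (cons_rV x x') y))) => //.
- move=> d T s u ms mu_.
  apply: (measurable_intRn (f := fun t x' => f (cons_rV (s t) x') (u t))) => //.
  move=> d' T' s' u' ms' mu'; apply: Bf.
    by apply: coord_measurable_cons => //; exact: measurableT_comp.
  by move=> i; exact: (measurableT_comp (mu_ i)).
- by move=> x y; exact: intRn_ge0.
Qed.

Lemma intRnZl n (f : 'rV[R]_n -> \bar R) (k : \bar R) :
  Bor f -> (forall x, 0 <= f x) -> 0 <= k ->
  intRn (fun x => k * f x) = k * intRn f.
Proof.
elim: n f => [//|n IH] f Bf f0 k0; rewrite !intRnS.
have Bc x : Bor (fun y => f (cons_rV x y)).
  by move=> d T u mu_; apply: Bf; exact: coord_measurable_cons.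
under eq_integral do rewrite IH//.
rewrite ge0_integralZl//; last by move=> x _; exact: intRn_ge0.
apply: (measurable_intRn (f := fun x y => f (cons_rV x y))) => //.
by move=> d T s u ms mu_; apply: Bf; exact: coord_measurable_cons.
Qed.

Lemma intRnD n (f g : 'rV[R]_n -> \bar R) :
  Bor f -> Bor g -> (forall x, 0 <= f x) -> (forall x, 0 <= g x) ->
  intRn (fun x => f x + g x) = intRn f + intRn g.
Proof.
elim: n f g => [//|n IH] f g Bf Bg f0 g0; rewrite !intRnS.
have Bc (h : 'rV[R]_n.+1 -> \bar R) (Bh : Bor h) x : Bor (fun y => h (cons_rV x y)).
  by move=> d T u mu_; apply: Bh; exact: coord_measurable_cons.
have mc (h : 'rV[R]_n.+1 -> \bar R) : Bor h -> (forall x, 0 <= h x) ->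
    measurable_fun setT (fun x => intRn (fun y => h (cons_rV x y))).
  move=> Bh h0; apply: (measurable_intRn (f := fun x y => h (cons_rV x y))) => //.
  by move=> d T s u ms mu_; apply: Bh; exact: coord_measurable_cons.
under eq_integral => x _ do rewrite (IH _ _ (Bc _ Bf x) (Bc _ Bg x))//.
rewrite ge0_integralD//.
- by move=> x _; exact: intRn_ge0.
- exact: mc.
- by move=> x _; exact: intRn_ge0.
- exact: mc.
Qed.

(** Each coordinate contributes one factor [a^-1] by the one-dimensional substitution. *)
Lemma intRn_affine n (f : 'rV[R]_n -> \bar R) (a : R) (b : 'rV[R]_n) :
  Bor f -> (forall x, 0 <= f x) -> (0 < a)%R ->
  intRn (fun x => f (a *: x + b)%R) = (a ^- n)%:E * intRn f.
Proof.
move=> + + a0; elim: n f b => [|n IH] f b Bf f0.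
  by rewrite /= expr0 invr1 mul1e !thinmx0.
have [b0 [b' ->]] : exists b0 b', b = cons_rV b0 b'.
  exists (b ord0 ord0), (\row_i b ord0 (lift ord0 i)).
  apply/rowP => i; have [j ->|->] := unliftP ord0 i.
    by rewrite cons_rVS mxE.
  by rewrite cons_rV0.
have E x y : (a *: cons_rV x y + cons_rV b0 b')%R = cons_rV (a * x + b0)%R (a *: y + b')%R.
  have S m (u v : 'rV[R]_m) i : ((a *: u + v) ord0 i = a * u ord0 i + v ord0 i)%R.
    by rewrite !mxE.
  apply/rowP => i; rewrite S; have [j ->|->] := unliftP ord0 i.
    by rewrite !cons_rVS S.
  by rewrite !cons_rV0.
rewrite !intRnS; under eq_integral => x _.
  under eq_intRn do rewrite E.
  rewrite (IH (fun y => f (cons_rV (a * x + b0)%R y)))//; last first.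
    by move=> d T u mu_; apply: Bf; exact: coord_measurable_cons.
  over.
have mf : measurable_fun setT (fun x => intRn (fun y => f (cons_rV x y))).
  apply: (measurable_intRn (f := fun x y => f (cons_rV x y))) => //.
  by move=> d T s u ms mu_; apply: Bf; exact: coord_measurable_cons.
rewrite ge0_integralZl//=; last 3 first.
- apply: (@measurableT_comp _ _ _ _ _ _ (fun x => intRn (fun y => f (cons_rV x y)))) => //.
  by apply: measurable_funD => //; exact: measurable_funM.
- by move=> x _; exact: intRn_ge0.
- by rewrite lee_fin invr_ge0 exprn_ge0// ltW.
rewrite (@ge0_integral_affine _ _ _ (fun x => intRn (fun y => f (cons_rV x y))))//.
  by rewrite muleA -EFinM -invfM -exprSr.
by move=> x; exact: intRn_ge0.
Qed.

End Bor.

(** * Prékopa-Leindler inequality *)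

Section BrunnMinkowski1.
Context {R : realType}.
Local Open Scope ereal_scope.
Local Notation mu := (@lebesgue_measure R).

Lemma lebesgue_measure_dilate (a b : R) (A : set R) : (0 < a)%R -> measurable A ->
  mu [set u | A ((u - b) / a)%R] = a%:E * mu A.
Proof.
move=> a0 mA; have ai0 : (0 < a^-1)%R by rewrite invr_gt0.
rewrite (lebesgue_measure_affine (- b / a)%R ai0 mA) muleA -EFinM mulfV ?mul1e//.
  congr (mu _); apply/seteqP; split => u /=;
  by rewrite (_ : a^-1 * u + - b / a = (u - b) / a)%R//; ring.
exact: lt0r_neq0.
Qed.

Lemma measurable_dilate (a b : R) (A : set R) : measurable A ->
  measurable [set u | A ((u - b) / a)%R].
Proof.
move=> mA; have : measurable_fun setT (fun u : R => (u - b) / a)%R.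
  by apply: measurable_funM => //; apply: measurable_funB.
by move=> /(_ measurableT _ mA); rewrite setTI.
Qed.

(** The truncations at points of [A] exhaust [A] up to its largest point, if there is one, and a
    point has measure zero. *)
Lemma le_measure_lt_points (A : set R) (M : \bar R) : measurable A -> A !=set0 ->
  (forall a, A a -> mu (A `&` `]-oo, a[) <= M) -> mu A <= M.
Proof.
move=> mA [a0 Aa0] H.
(* [e] increases to the supremum of [A] while staying strictly below points of [A]; [s] is that
   supremum, the only point that may escape, and a dummy 0 when [A] is unbounded. *)
have [e [s [e_nd e_A A_e]]] : exists (e : R^nat) (s : R), [/\ nondecreasing_seq e,
    forall n, exists2 a, A a & (e n < a)%R &
    forall a, A a -> a = s \/ exists n, (a <= e n)%R].
  have [ubA|nubA] := pselect (has_ubound A).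
    have supA : has_sup A by split => //; exists a0.
    exists (fun n => sup A - n.+1%:R^-1)%R, (sup A); split.
    - by move=> m n mn; rewrite lerB// lef_pV2 ?posrE// ler_nat ltnS.
    - move=> n; have [a Aa sa] := @sup_adherent _ A n.+1%:R^-1 (ltac:(by rewrite invr_gt0)) supA.
      by exists a.
    - move=> a Aa; have [->|/eqP as_] := eqVneq a (sup A); first by left.
      right; have lt_as : (a < sup A)%R.
        by rewrite lt_neqAle ub_le_sup// andbT; exact/eqP.
      exists (Num.truncn (sup A - a)^-1)%R.
      rewrite lerBrDr -lerBrDl -[leRHS]invrK lef_pV2 ?posrE ?invr_gt0 ?subr_gt0//.
      exact/ltW/truncnS_gt.
  exists (fun n => n%:R)%R, 0%R; split.
  - by move=> m n mn; rewrite ler_nat.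
  - move=> n; apply: contrapT => nA; apply: nubA; exists n%:R => a Aa.
    by rewrite leNgt; apply/negP => na; apply: nA; exists a.
  - move=> a Aa; right; exists (Num.truncn `|a|).+1.
    by apply: le_trans (ler_norm a) _; exact/ltW/truncnS_gt.
pose F n := A `&` `]-oo, e n].
have mF n : measurable (F n) by apply: measurableI.
have mbF : measurable (\bigcup_n F n) by exact: bigcupT_measurable.
have cF : mu \o F @ \oo --> mu (\bigcup_n F n).
  apply: nondecreasing_cvg_mu => //. move=> m n mn; apply/subsetPset; apply: setIS => x /=; rewrite !in_itv /= => /le_trans.
  by apply; exact: e_nd.
have FM : mu (\bigcup_n F n) <= M.
  rewrite -(cvg_lim _ cF)//; apply: lime_le; first by apply/cvg_ex; eexists; exact: cF.
  apply: nearW => n /=; have [a Aa ena] := e_A n; apply: le_trans (H _ Aa).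
  apply: le_measure; rewrite ?inE; [exact: mF|exact: measurableI|].
  by move=> x [Ax /=]; rewrite in_itv /= => xe; split => //=; rewrite in_itv /= (le_lt_trans xe).
apply: le_trans FM; apply: (@le_trans _ _ (mu (\bigcup_n F n `|` [set s]))).
  apply: le_measure; rewrite ?inE; [exact: mA|exact: measurableU|].
  move=> a Aa; have [->|[n an]] := A_e _ Aa; first by right.
  by left; exists n => //; split => //=; rewrite in_itv.
apply: le_trans (measureU2 _ _ _) _ => //.
by rewrite [X in _ + X]lebesgue_measure_set1 adde0.
Qed.

Lemma le_measure_gt_points (A : set R) (M : \bar R) : measurable A -> A !=set0 ->
  (forall a, A a -> mu (A `&` `]a, +oo[) <= M) -> mu A <= M.
Proof.
have muN (B : set R) : measurable B -> mu [set - x | x in B]%R = mu B.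
  move=> mB; rewrite -(lebesgue_measureN mB) /pushforward; congr (mu _).
  apply/seteqP; split => x /= => [[y By <-]|Bx]; first by rewrite opprK.
  by exists (- x)%R; rewrite ?opprK.
have mN (B : set R) : measurable B -> measurable [set - x | x in B]%R.
  move=> mB; have := @oppr_measurable R setT measurableT _ mB.
  rewrite setTI; congr (measurable _); apply/seteqP; split => x /=.
    by move=> Bx; exists (- x)%R; rewrite ?opprK.
  by move=> [y By <-]; rewrite opprK.
move=> mA [a0 Aa0] H; rewrite -muN//; apply: le_measure_lt_points; first exact: mN.
  by exists (- a0)%R; exists a0.
move=> _ [a Aa <-]; apply: le_trans (H _ Aa); rewrite -[leRHS]muN; last exact: measurableI.
apply: le_measure; rewrite ?inE.
- by apply: measurableI => //; exact: mN.
- by apply: mN; exact: measurableI.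
- move=> _ [[y Ay <-] /=]; rewrite in_itv /= ltrN2 => ay.
  by exists y => //; split => //=; rewrite in_itv/= ay.
Qed.

(** For a in A and b in B, the part of A left of a, combined with b, and the part of B right of b,
    combined with a, give two subsets of C lying on either side of (1 - t) a + t b. Their measures
    add up, and then a and b vary. *)
Lemma brunn_minkowski1 (t : R) (A B C : set R) : (0 < t < 1)%R ->
  measurable A -> measurable B -> measurable C -> A !=set0 -> B !=set0 ->
  (forall a b, A a -> B b -> C ((1 - t) * a + t * b)%R) ->
  (1 - t)%:E * mu A + t%:E * mu B <= mu C.
Proof.
move=> /andP[t0 t1] mA mB mC A0 B0 ABC.
have t1' : (0 < 1 - t)%R by rewrite subr_gt0.
have key a b : A a -> B b ->
    (1 - t)%:E * mu (A `&` `]-oo, a[) + t%:E * mu (B `&` `]b, +oo[) <= mu C.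
  move=> Aa Bb.
  rewrite -(lebesgue_measure_dilate (t * b) t1')//; last exact: measurableI.
  rewrite -(lebesgue_measure_dilate ((1 - t) * a) t0)//; last exact: measurableI.
  set A1 := [set u | (A `&` _) _]; set B1 := [set u | (B `&` _) _].
  have mA1 : measurable A1 by apply: measurable_dilate; exact: measurableI.
  have mB1 : measurable B1 by apply: measurable_dilate; exact: measurableI.
  rewrite -measureU//.
    apply: le_measure; rewrite ?inE; [exact: measurableU|exact: mC|].
    move=> u [[/= Au _]|[/= Bu _]].
      by have := ABC _ _ Au Bb; congr C; field; exact: lt0r_neq0.
    by have := ABC _ _ Aa Bu; congr C; field; exact: lt0r_neq0.
  apply/seteqP; split => // u [[/= _ +] [/= _]].
  rewrite !in_itv /= andbT ltr_pdivrMr// ltr_pdivlMr//; lra.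
have ge0 k x : (0 <= k)%R -> 0 <= k%:E * mu x by move=> k0; rewrite mule_ge0// lee_fin.
have [[a0 Aa0] [b0 Bb0]] := (A0, B0).
have [CE|Coo] := eqVneq (mu C) +oo; first by rewrite CE leey.
have Cfin : mu C \is a fin_num by rewrite ge0_fin_numE// ltey.
(* The truncations are removed one set at a time; the other term is moved across the inequality,
   which is legitimate because it is bounded by the finite measure of [C]. *)
have stepA b : B b -> (1 - t)%:E * mu A + t%:E * mu (B `&` `]b, +oo[) <= mu C.
  move=> Bb; set c := t%:E * _.
  have c0 : 0 <= c by apply: ge0; exact: ltW.
  have cC : c <= mu C.
    by apply: le_trans (key _ _ Aa0 Bb); rewrite leeDr// ge0// ltW.
  have cfin : c \is a fin_num by rewrite ge0_fin_numE// (le_lt_trans cC)// ltey.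
  rewrite -leeBrDr// -lee_pdivlMl//; apply: le_measure_lt_points => // a Aa.
  by rewrite lee_pdivlMl// leeBrDr//; exact: key.
set c := (1 - t)%:E * _.
have c0 : 0 <= c by apply: ge0; exact: ltW.
have cC : c <= mu C by apply: le_trans (stepA _ Bb0); rewrite leeDl// ge0// ltW.
have cfin : c \is a fin_num by rewrite ge0_fin_numE// (le_lt_trans cC)// ltey.
rewrite addeC -leeBrDr// -lee_pdivlMl//; apply: le_measure_gt_points => // b Bb.
by rewrite lee_pdivlMl// leeBrDr// addeC; exact: stepA.
Qed.

End BrunnMinkowski1.

Section PrekopaLeindler1.
Context {R : realType}.
Local Open Scope ereal_scope.
Local Notation mu := (@lebesgue_measure R).

Lemma powR_amgm (t a b : R) : (0 < t < 1 -> 0 <= a -> 0 <= b ->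
  a `^ (1 - t) * b `^ t <= (1 - t) * a + t * b)%R.
Proof.
move=> /andP[t0 t1] a0 b0; have t1' : (0 < 1 - t)%R by rewrite subr_gt0.
have := @conjugate_powR R (a `^ (1 - t))%R (b `^ t)%R (1 - t)^-1%R t^-1%R
  (powR_ge0 _ _) (powR_ge0 _ _).
rewrite !invr_gt0 !invrK => /(_ t1' t0 (subrK _ _)); rewrite -!powRrM.
by rewrite !mulfV ?lt0r_neq0// !powRr1// [(a * _)%R]mulrC [(b * _)%R]mulrC.
Qed.

Lemma poweR_amgm (t : R) (I J : \bar R) : (0 < t < 1)%R -> 0 <= I -> 0 <= J ->
  poweR I (1 - t) * poweR J t <= (1 - t)%:E * I + t%:E * J.
Proof.
move=> t01; have /andP[t0 t1] := t01.
have t1' : (0 < 1 - t)%R by rewrite subr_gt0.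
case: I => [a| |]// I0; case: J => [b| |]// J0.
- by rewrite !poweR_EFin -!EFinM -EFinD lee_fin powR_amgm.
- by rewrite [leRHS]addeC gt0_muley ?lte_fin// addye ?leey.
- by rewrite gt0_muley ?lte_fin// addye ?leey.
- by rewrite gt0_muley ?lte_fin// addye ?leey ?gt0_muley ?lte_fin.
Qed.

Let andP_set (P : Prop) (A : R -> Prop) : P -> [set x | P /\ A x] = [set x | A x].
Proof. by move=> HP; apply/seteqP; split => x /= => [[]|]. Qed.

Let notandP_set (P : Prop) (A : R -> Prop) : ~ P -> [set x | P /\ A x] = set0.
Proof. by move=> HP; apply/seteqP; split => x //= [/HP]. Qed.

(** Layer-cake formula for the truncation at [c], with levels rescaled to ]0, 1[ so that functions
    truncated at different heights can be compared level by level. *)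
Lemma integral_mine_layer (h : R -> \bar R) (c : R) : (0 < c)%R ->
  measurable_fun setT h -> (forall x, 0 <= h x) ->
  \int[mu]_x mine (h x) c%:E =
  c%:E * \int[mu]_(s in `]0%R, 1%R[) mu [set x | (s * c)%:E < h x].
Proof.
move=> c0 mh h0.
pose S := [set z : R * R | (0 < z.2 < 1)%R /\ (z.2 * c)%:E < h z.1].
have mS : measurable (S : set (measurableTypeR R * measurableTypeR R)).
  rewrite (_ : S = (setT `*` `]0%R, 1%R[) `&`
      (setT `&` [set z : R * R | (z.2 * c)%:E < h z.1])); last first.
    by apply/seteqP; split => z; rewrite /S /= in_itv /=; tauto.
  apply: measurableI; first exact: measurableX.
  apply: measurable_lte => //.
    apply/measurable_EFinP; apply: measurable_funM => //.
  exact: measurableT_comp.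
have T := @fubini_tonelli _ _ _ _ _ mu mu (fun z : measurableTypeR R * measurableTypeR R => (\1_S z)%:E).
have {}T := T ltac:(by apply/measurable_EFinP; exact: measurable_indic) ltac:(by move=> x; rewrite lee_fin).
have m1 x : measurable [set s : R | (0 < s < 1)%R /\ (s * c)%:E < h x].
  have := measurable_xsection x mS; congr (measurable _).
  by apply/seteqP; split => s; rewrite /xsection /= ?inE.
have m2 s : measurable [set x : R | (0 < s < 1)%R /\ (s * c)%:E < h x].
  have := measurable_ysection s mS; congr (measurable _).
  by apply/seteqP; split => x; rewrite /ysection /= ?inE.
pose Phi x := \int[mu]_s (\1_S (x, s))%:E.
have mPhi : measurable_fun setT Phi.
  apply: (@measurable_fun_fubini_tonelli_F _ _ _ _ _ mu
    (fun z : measurableTypeR R * measurableTypeR R => (\1_S z)%:E)).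
    by apply/measurable_EFinP; exact: measurable_indic.
  by move=> z; rewrite lee_fin.
have Phi0 x : 0 <= Phi x by apply: integral_ge0 => s _; rewrite lee_fin.
transitivity (c%:E * \int[mu]_x Phi x).
  rewrite -(@ge0_integralZl _ _ _ mu setT measurableT Phi mPhi c%:E (fun x _ => Phi0 x) (ltac:(by rewrite lee_fin ltW))).
  apply: eq_integral => x _.
  transitivity (c%:E * mu [set s : R | (0 < s < 1)%R /\ (s * c)%:E < h x]).
    have hx0 := h0 x; case: (leP c%:E (h x)) => hc.
      rewrite (_ : [set s | _] = `]0%R, 1%R[%classic).
        by rewrite lebesgue_measure_itv /= lte_fin ltr01 -EFinB subr0 mule1.
      apply/seteqP; split => s /=; rewrite in_itv /=; first by case.
      move=> /[dup] s01 /andP[s0 s1]; split; first exact: s01.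
      by apply: lt_le_trans hc; rewrite lte_fin gtr_pMl.
    case: (h x) hx0 hc => [r r0 rc| _ |+ _]; [|by rewrite ltNge leey|by rewrite leNgt ltNyr].
    move: r0 rc; rewrite lee_fin lte_fin => r0 rc.
    rewrite (_ : [set s | _] = `]0%R, (r / c)%R[%classic).
      rewrite lebesgue_measure_itv /= lte_fin.
      have [r_gt0|] := ltP 0%R (r / c)%R.
        by rewrite -EFinB subr0 -EFinM mulrC divfK; last exact: lt0r_neq0.
      rewrite pmulr_lle0; last by rewrite invr_gt0.
      move=> r_le0; rewrite mule0.
      by congr EFin; apply/eqP; rewrite eq_le r_le0.
    apply/seteqP; split => s /=; rewrite in_itv /= lte_fin (ltr_pdivlMr _ _ c0).
      by case=> /andP[-> _].
    move=> /andP[s0 sr]; split; last exact: sr.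
    rewrite s0 /=.
    by have := lt_trans sr rc; rewrite gtr_pMl.
  congr (_ * _); rewrite /Phi -[X in mu X]setIT -(integral_indic mu measurableT (m1 x)).
  by apply: eq_integral => s _; rewrite !indicE; congr (_%:R%:E); apply/idP/idP; rewrite !inE.
rewrite T; congr (_ * _); rewrite [RHS]integral_mkcond; apply: eq_integral => s _.
transitivity (mu [set x : R | (0 < s < 1)%R /\ (s * c)%:E < h x]).
  rewrite -[X in _ = mu X]setIT -(integral_indic mu measurableT (m2 s)).
  by apply: eq_integral => x _; rewrite !indicE; congr (_%:R%:E); apply/idP/idP; rewrite !inE.
rewrite patchE; case: ifPn => [|/negP]; rewrite inE /= in_itv /= => s01.
  by rewrite (andP_set (fun x => (s * c)%:E < h x) s01).
by rewrite (notandP_set _ s01); exact: measure0.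
Qed.

(** Heights are normalized to [A] and [B]: points where f > s A and g > s B combine to points where
    h > s c with c = A^(1 - t) B^t. The one-dimensional Brunn-Minkowski inequality at each level s,
    which requires both level sets to be nonempty, is integrated in s, and the arithmetic-geometric
    mean inequality turns the product into a sum. *)
Lemma prekopa_leindler1_mine (t A B : R) (f g h : R -> \bar R) : (0 < t < 1)%R ->
  measurable_fun setT f -> measurable_fun setT g -> measurable_fun setT h ->
  (forall x, 0 <= f x) -> (forall x, 0 <= g x) -> (forall x, 0 <= h x) ->
  (forall x y, poweR (f x) (1 - t) * poweR (g y) t <= h ((1 - t) * x + t * y)%R) ->
  (0 < A)%R -> (0 < B)%R ->
  (forall s, (s < 1)%R -> exists x, (s * A)%:E < f x) ->
  (forall s, (s < 1)%R -> exists y, (s * B)%:E < g y) ->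
  poweR (\int[mu]_x mine (f x) A%:E) (1 - t) *
    poweR (\int[mu]_x mine (g x) B%:E) t <= \int[mu]_x h x.
Proof.
move=> t01 mf mg mh f0 g0 h0 fgh A0 B0 fA gB.
have /andP[t0 t1] := t01; have t1' : (0 < 1 - t)%R by rewrite subr_gt0.
pose c := (A `^ (1 - t) * B `^ t)%R.
have c0 : (0 < c)%R by rewrite mulr_gt0// powR_gt0.
have m_lt k (u : R -> \bar R) : measurable_fun setT u -> measurable [set x | k < u x].
  by move=> mu_; have := emeasurable_fun_o_infty measurableT mu_ k; rewrite setTI.
have m_meas k (u : R -> \bar R) : measurable_fun setT u -> (forall x, 0 <= u x) ->
    measurable_fun (`]0%R, 1%R[ : set R) (fun s => mu [set x | (s * k)%:E < u x]).
  move=> mu_ u0; apply: measurable_funTS.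
  have mS : measurable ([set z : R * R | (z.1 * k)%:E < u z.2] : set (measurableTypeR R * measurableTypeR R)).
    rewrite -[X in measurable X]setTI; apply: measurable_lte => //.
      by apply/measurable_EFinP; exact: measurable_funM.
    exact: measurableT_comp.
  rewrite (_ : (fun s => _) = mu \o xsection [set z : R * R | (z.1 * k)%:E < u z.2]).
    exact: (@measurable_fun_xsection _ _ (measurableTypeR R) (measurableTypeR R) R mu _ mS).
  apply/funext => s /=; congr (mu _).
  by apply/seteqP; split => x; rewrite /xsection /= inE.
apply: (@le_trans _ _ (\int[mu]_x mine (h x) c%:E)); last first.
  apply: ge0_le_integral_nomeas => x; last by rewrite ge_min lexx.
  by rewrite le_min h0 lee_fin ltW.
rewrite !integral_mine_layer//.
set IF := \int[mu]_(s in _) mu [set x | _ < f x].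
set IG := \int[mu]_(s in _) mu [set x | _ < g x].
have IF0 : 0 <= IF by apply: integral_ge0 => s _; exact: measure_ge0.
have IG0 : 0 <= IG by apply: integral_ge0 => s _; exact: measure_ge0.
rewrite !poweRM ?lee_fin ?(ltW A0) ?(ltW B0)//.
rewrite muleACA -EFinM -/c lee_pmul2l ?lte_fin//.
apply: le_trans (poweR_amgm t01 IF0 IG0) _.
have mI : measurable (`]0%R, 1%R[%classic : set R) by [].
have mF := m_meas A f mf f0; have mG := m_meas B g mg g0; have mH := m_meas c h mh h0.
have ge0_meas k (u : R -> \bar R) s : 0 <= mu [set x | (s * k)%:E < u x].
  exact: measure_ge0.
rewrite -(ge0_integralZl mu mI mF (fun s _ => ge0_meas A f s)); last by rewrite lee_fin ltW.
rewrite -(ge0_integralZl mu mI mG (fun s _ => ge0_meas B g s)); last by rewrite lee_fin ltW.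
rewrite -ge0_integralD //; first last.
- exact: measurable_funeM.
- by move=> s _; rewrite mule_ge0// lee_fin ltW.
- exact: measurable_funeM.
- by move=> s _; rewrite mule_ge0// lee_fin ltW.
apply: ge0_le_integral => //.
- by move=> s _; rewrite adde_ge0// mule_ge0// lee_fin ltW.
- by apply: emeasurable_funD; exact: measurable_funeM.
move=> s /=; rewrite in_itv /= => /andP[s0 s1].
apply: brunn_minkowski1 => //; do ?exact: m_lt.
- exact: fA.
- exact: gB.
move=> x y /= sf sg; apply: lt_le_trans (fgh x y).
have E : (s * c = (s * A) `^ (1 - t) * (s * B) `^ t)%R.
  rewrite !powRM ?(ltW s0) ?(ltW A0) ?(ltW B0)// mulrACA -/c -powRD.
    by rewrite subrK powRr1// ltW.
  by rewrite subrK (gt_eqF ltr01).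
have sA0 : (0 < s * A)%R by rewrite mulr_gt0.
have sB0 : (0 < s * B)%R by rewrite mulr_gt0.
have lt_pow k p z : (0 < k)%R -> (0 < p)%R -> k%:E < z -> (k `^ p)%:E < poweR z p.
  move=> k0 p0; case: z => [z| _|]; last 2 first.
  - by rewrite poweRyr ?lt0r_neq0// ltry.
  - by rewrite ltNge leNye.
  rewrite !lte_fin => kz; apply: (gt0_ltr_powR p0) => //; rewrite nnegrE ltW//.
  exact: lt_trans kz.
rewrite E EFinM; apply: lte_pmul; rewrite ?lee_fin ?powR_ge0//; exact: lt_pow.
Qed.

(** Replaces a continuity argument for [poweR]: the inequality is solved for [x], which bounds [I]
    itself. *)
Lemma poweR_mul_le_sup (p : R) (I c H : \bar R) : (0 < p)%R -> 0 < I -> 0 <= c ->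
  0 <= H -> (forall x, (0 < x)%R -> x%:E < I -> (x `^ p)%:E * c <= H) ->
  poweR I p * c <= H.
Proof.
move=> p0 I0 c0 H0 xH.
case: H => [H| |] in H0 xH *; rewrite ?leey//.
have Iex : exists2 x, (0 < x)%R & x%:E < I.
  case: I I0 {xH} => [r| |]//; last by move=> _; exists 1%R; rewrite ?ltry.
  by rewrite lte_fin => r0; exists (r / 2)%R; rewrite ?lte_fin; lra.
case: c => [c| |]// in c0 xH *; last first.
  have [x x0 xI] := Iex; have := xH x x0 xI.
  by rewrite gt0_muley ?lte_fin ?powR_gt0.
move: c0; rewrite lee_fin le_eqVlt => /predU1P[<-|c0]; first by rewrite mule0.
have le_root x : (0 < x)%R -> x%:E < I -> (x <= (H / c) `^ p^-1)%R.
  move=> x0 /xH -/(_ x0); rewrite -EFinM lee_fin -ler_pdivlMr// => le_xH.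
  rewrite -[leLHS](powRr1 (ltW x0)) -(mulfV (lt0r_neq0 p0)) powRrM.
  by apply: ge0_ler_powR; rewrite ?nnegrE ?invr_ge0 ?(ltW p0) ?powR_ge0// divr_ge0// ltW.
have I_le : I <= ((H / c) `^ p^-1)%:E.
  rewrite leNgt; apply/negP => I_gt.
  have [z zI zg] : exists2 z, z%:E < I & ((H / c) `^ p^-1 < z)%R.
    case: I I_gt {xH le_root I0 Iex} => [r| |]//.
      rewrite lte_fin => rg; exists (((H / c) `^ p^-1 + r) / 2)%R; rewrite ?lte_fin; lra.
    by move=> _; exists ((H / c) `^ p^-1 + 1)%R; rewrite ?ltry// ltrDl.
  have := le_root z (le_lt_trans (powR_ge0 _ _) zg) zI.
  by rewrite leNgt zg.
rewrite muleC -lee_pdivlMl//; apply: le_trans (gt0_ler_poweR (ltW p0) _ _ I_le) _.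
- by rewrite in_itv /= (ltW I0) leey.
- by rewrite in_itv /= lee_fin powR_ge0 leey.
have Hc : (0 <= H / c)%R by rewrite divr_ge0// ltW.
rewrite poweR_EFin -powRrM mulVf ?lt0r_neq0// (powRr1 Hc).
by rewrite -EFinM lee_fin mulrC.
Qed.

Lemma ge0_integral_mine_gt (f : R -> \bar R) (x : R) : measurable_fun setT f ->
  (forall x, 0 <= f x) -> x%:E < \int[mu]_x f x ->
  exists2 n : nat, (0 < n)%N & forall m, (n <= m)%N -> x%:E < \int[mu]_x mine (f x) m%:R%:E.
Proof.
move=> mf f0 xI.
have fE y : limn (fun n => mine (f y) n%:R%:E) = f y.
  apply/cvg_lim => //; case: (f y) (f0 y) => [r r0|_|//].
    apply: cvg_near_cst; near=> n; rewrite min_l// lee_fin.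
    by near: n; exact: nbhs_infty_ger.
  rewrite (_ : (fun n => _) = EFin \o (fun n => n%:R)).
    by apply/cvgeryP; exact: cvgr_idn.
  by apply/funext => n; rewrite min_r// leey.
have cf : \int[mu]_x mine (f x) n%:R%:E @[n --> \oo] --> \int[mu]_x f x.
  have := @cvg_monotone_convergence _ _ _ mu setT measurableT
    (fun n x => mine (f x) n%:R%:E).
  under [in X in _ --> X]eq_integral do rewrite fE.
  apply.
  - move=> n; apply: measurable_mine; [exact: mf|exact: measurable_cst].
  - by move=> n y _; rewrite le_min f0 lee_fin ler0n.
  - by move=> y _ m n mn; rewrite le_min ge_min lexx/= ge_min lee_fin ler_nat mn orbT.
apply: contrapT => nH.
have le_x m : \int[mu]_x mine (f x) m%:R%:E <= x%:E.
  rewrite leNgt; apply/negP => xm; apply: nH; exists m.+1 => // k mk.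
  apply: lt_le_trans xm _; apply: ge0_le_integral_nomeas => y.
    by rewrite le_min f0 lee_fin ler0n.
  by rewrite le_min ge_min lexx/= ge_min lee_fin ler_nat (ltnW mk) orbT.
have : limn (fun m => \int[mu]_x mine (f x) m%:R%:E) <= x%:E.
  apply: lime_le; last exact: nearW.
  by apply/cvg_ex; eexists; exact: cf.
by rewrite (cvg_lim _ cf)// leNgt xI.
Unshelve. all: by end_near. Qed.

Lemma prekopa_leindler1 (t : R) (f g h : R -> \bar R) : (0 < t < 1)%R ->
  measurable_fun setT f -> measurable_fun setT g -> measurable_fun setT h ->
  (forall x, 0 <= f x) -> (forall x, 0 <= g x) -> (forall x, 0 <= h x) ->
  (forall x y, poweR (f x) (1 - t) * poweR (g y) t <= h ((1 - t) * x + t * y)%R) ->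
  poweR (\int[mu]_x f x) (1 - t) * poweR (\int[mu]_x g x) t <= \int[mu]_x h x.
Proof.
move=> t01 mf mg mh f0 g0 h0 fgh.
have /andP[t0 t1] := t01; have t1' : (0 < 1 - t)%R by rewrite subr_gt0.
have h0' : 0 <= \int[mu]_x h x by exact: integral_ge0.
have [->|If] := eqVneq (\int[mu]_x f x) 0; first by rewrite poweR0r ?lt0r_neq0// mul0e.
have [->|Ig] := eqVneq (\int[mu]_x g x) 0; first by rewrite poweR0r ?lt0r_neq0// mule0.
have {}If : 0 < \int[mu]_x f x by rewrite lt_neqAle eq_sym If integral_ge0.
have {}Ig : 0 < \int[mu]_x g x by rewrite lt_neqAle eq_sym Ig integral_ge0.
apply: poweR_mul_le_sup => //; first exact: poweR_ge0.
move=> x x0 xI; rewrite muleC; apply: poweR_mul_le_sup => //.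
  by rewrite lee_fin powR_ge0.
move=> y y0 yI.
(* If some value of [u] exceeds the truncation height [n], then [n] serves as [A]; otherwise [u] is
   bounded, and its supremum serves, the truncation there changing nothing. *)
have level (u : R -> \bar R) z : measurable_fun setT u -> (forall x, 0 <= u x) ->
    (0 < z)%R -> z%:E < \int[mu]_x u x -> exists A : R, [/\ (0 < A)%R,
    forall s, (s < 1)%R -> exists x, (s * A)%:E < u x &
    z%:E < \int[mu]_x mine (u x) A%:E].
  move=> mu_ u0 z0 /(ge0_integral_mine_gt mu_ u0)[n n0 zn].
  have [[a na]|nouy] := pselect (exists a, n%:R%:E < u a).
    exists n%:R; split; rewrite ?ltr0n//; last exact: zn.
    move=> s s1; exists a; apply: le_lt_trans na.
    by rewrite lee_fin ger_pMl ?ltr0n// ltW.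
  pose E := [set r : R | exists a, r%:E = u a].
  have ub_E : ubound E n%:R.
    move=> r [a ra]; rewrite leNgt; apply/negP => nr.
    by apply: nouy; exists a; rewrite -ra lte_fin.
  have uE a : exists2 r, u a = r%:E & E r.
    case ua : (u a) (u0 a) => [r| |]// _; first by exists r => //; exists a.
    by exfalso; apply: nouy; exists a; rewrite ua ltry.
  have supE : has_sup E.
    by split; [have [r _ Er] := uE 0%R; exists r | exists n%:R].
  have u_le a : u a <= (sup E)%:E.
    by have [r -> Er] := uE a; rewrite lee_fin ub_le_sup//; exists n%:R.
  have supE_gt0 : (0 < sup E)%R.
    rewrite ltNge; apply/negP => sE0.
    have := zn n (leqnn n); rewrite integral0_eq ?lte_fin ?ltNge ?(ltW z0)// => a _.
    rewrite (_ : u a = 0) ?min_l ?lee_fin//.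
    apply/eqP; rewrite eq_le u0 andbT; apply: le_trans (u_le a) _.
    by rewrite lee_fin.
  exists (sup E); split => //.
  - move=> s s1.
    have [r [a ra] rs] := @sup_adherent _ E ((1 - s) * sup E)%R (ltac:(by rewrite mulr_gt0// subr_gt0)) supE.
    exists a; rewrite -ra lte_fin; apply: le_lt_trans rs; lra.
  - apply: lt_le_trans (zn n (leqnn n)) _; apply: ge0_le_integral_nomeas => a.
      by rewrite le_min u0 lee_fin ler0n.
    by rewrite le_min !ge_min lexx/= u_le.
have [A [A0 fA xA]] := level _ _ mf f0 x0 xI.
have [B [B0 gB yB]] := level _ _ mg g0 y0 yI.
apply: le_trans (prekopa_leindler1_mine t01 mf mg mh f0 g0 h0 fgh A0 B0 fA gB).
rewrite muleC; apply: lee_pmul; rewrite ?lee_fin ?powR_ge0// -poweR_EFin;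
apply: gt0_ler_poweR; rewrite ?in_itv /= ?leey ?andbT ?lee_fin; try exact: ltW.
all: by apply: integral_ge0 => a _; rewrite le_min ?f0 ?g0 lee_fin ltW.
Qed.
End PrekopaLeindler1.

Section PrekopaLeindler.
Context {R : realType}.
Local Open Scope ereal_scope.
Local Notation mu := (@lebesgue_measure R).

(** For fixed first coordinates x and y the sections of [f], [g] and [h] satisfy the hypothesis in
    one dimension less, so the section integrals satisfy that of the one-dimensional case. *)
Theorem prekopa_leindler n (t : R) (f g h : 'rV[R]_n -> \bar R) : (0 < t < 1)%R ->
  Bor f -> Bor g -> Bor h ->
  (forall x, 0 <= f x) -> (forall x, 0 <= g x) -> (forall x, 0 <= h x) ->
  (forall x y, poweR (f x) (1 - t) * poweR (g y) t <= h ((1 - t) *: x + t *: y)%R) ->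
  poweR (intRn f) (1 - t) * poweR (intRn g) t <= intRn h.
Proof.
move=> t01; elim: n f g h => [|n IH] f g h Bf Bg Bh f0 g0 h0 fgh.
  by have := fgh 0%R 0%R; rewrite [X in h X]thinmx0.
have Bc (u : 'rV[R]_n.+1 -> \bar R) (Bu : Bor u) x : Bor (fun y => u (cons_rV x y)).
  by move=> d T v mv; apply: Bu; exact: coord_measurable_cons.
have mc (u : 'rV[R]_n.+1 -> \bar R) : Bor u -> (forall x, 0 <= u x) ->
    measurable_fun setT (fun x => intRn (fun y => u (cons_rV x y))).
  move=> Bu u0; apply: (measurable_intRn (f := fun x y => u (cons_rV x y))) => //.
  by move=> d T s v ms mv; apply: Bu; exact: coord_measurable_cons.
rewrite !intRnS; apply: prekopa_leindler1 => //; do ?exact: mc;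
  do ?[by move=> x; exact: intRn_ge0].
move=> x y; apply: IH => //; do ?exact: Bc.
move=> x' y'; apply: le_trans (fgh _ _) _.
rewrite le_eqVlt; apply/orP; left; apply/eqP; congr h.
have S m (u v : 'rV[R]_m) i : (((1 - t) *: u + t *: v) ord0 i =
    (1 - t) * u ord0 i + t * v ord0 i)%R by rewrite !mxE.
apply/rowP => i; rewrite S; have [j ->|->] := unliftP ord0 i.
  by rewrite !cons_rVS S.
by rewrite !cons_rV0.
Qed.

End PrekopaLeindler.

(** * Mellin transforms of log-concave functions and the Gamma function *)

Section Mellin.
Context {R : realType}.
Local Open Scope ereal_scope.
Local Notation mu := (@lebesgue_measure R).
Implicit Types (p c : R) (phi : R -> \bar R).

(** Shaped so that [rhoH_pow al f xi] is convertible to the transform of [corr f] along the ray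
    through [xi]. *)
Definition Mellin p phi :=
  \int[mu]_(t in `]0%R, +oo[) ((t `^ (p - 1))%:E * phi t).

Lemma measurable_Mellin_integrand p phi D : measurable_fun setT phi ->
  measurable_fun D (fun t => (t `^ (p - 1))%:E * phi t).
Proof.
move=> mphi; apply: measurable_funTS; apply: emeasurable_funM => //.
by apply/measurable_EFinP; exact: measurable_powR.
Qed.

Lemma Mellin_ge0 p phi : (forall t, 0 <= phi t) -> 0 <= Mellin p phi.
Proof.
by move=> phi0; apply: integral_ge0 => t _; rewrite mule_ge0// lee_fin powR_ge0.
Qed.

Lemma le_Mellin p phi psi : (forall t, 0 <= phi t) ->
  (forall t, (0 < t)%R -> phi t <= psi t) -> Mellin p phi <= Mellin p psi.
Proof.
move=> phi0 le_phi; rewrite /Mellin integral_mkcond [leRHS]integral_mkcond.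
apply: ge0_le_integral_nomeas => t; rewrite !patchE; case: ifPn => //.
  by move=> _; rewrite mule_ge0// lee_fin powR_ge0.
rewrite inE /= in_itv /= andbT => t0; apply: lee_wpmul2l; last exact: le_phi.
by rewrite lee_fin powR_ge0.
Qed.

Lemma eq_Mellin p phi psi : (forall t, (0 < t)%R -> phi t = psi t) ->
  Mellin p phi = Mellin p psi.
Proof.
move=> H; apply: eq_integral => t; rewrite inE /= in_itv /= andbT => t0.
by rewrite H.
Qed.

Lemma MellinZ p phi k : measurable_fun setT phi -> (forall t, 0 <= phi t) -> 0 <= k ->
  Mellin p (fun t => k * phi t) = k * Mellin p phi.
Proof.
move=> mphi phi0 k0; rewrite /Mellin -ge0_integralZl//.
- by apply: eq_integral => t _; rewrite muleCA.
- exact: measurable_Mellin_integrand.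
- by move=> t _; rewrite mule_ge0// lee_fin powR_ge0.
Qed.

Lemma Mellin_dilate p phi c : measurable_fun setT phi -> (forall t, 0 <= phi t) ->
  (0 < c)%R -> Mellin p (fun t => phi (c * t)%R) = (c `^ - p)%:E * Mellin p phi.
Proof.
move=> mphi phi0 c0.
pose g (t : R) : \bar R := ((fun t => (t `^ (p - 1))%:E * phi t) \_ `]0%R, +oo[%classic) t.
have g0 t : 0 <= g t.
  rewrite /g patchE; case: ifP => // _.
  by rewrite mule_ge0// lee_fin powR_ge0.
have mg : measurable_fun setT g.
  by apply/(measurable_restrictT _ _).1 => //; exact: measurable_Mellin_integrand.
have -> : Mellin p phi = \int[mu]_x g x by rewrite /Mellin integral_mkcond.
transitivity ((c `^ (1 - p))%:E * \int[mu]_x g (c * x + 0)%R).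
  rewrite -ge0_integralZl//; last 2 first.
    apply: (measurableT_comp mg).
    by apply: measurable_funD => //; exact: measurable_funM.
    by rewrite lee_fin powR_ge0.
  rewrite /Mellin [LHS]integral_mkcond; apply: eq_integral => t _.
  rewrite /g !patchE addr0; case: ifPn => [|/negP]; rewrite inE /= in_itv /= andbT => t0.
    rewrite ifT; last by rewrite inE /= in_itv /= andbT mulr_gt0.
    rewrite muleA -EFinM powRM ?(ltW t0) ?(ltW c0)// mulrA -powRD.
      by rewrite (_ : 1 - p + (p - 1) = 0)%R ?powRr0 ?mul1r//; ring.
    by rewrite (gt_eqF c0) implybT.
  rewrite ifF ?mule0//; apply/negbTE/negP; apply: contra_not t0.
  by rewrite inE /= in_itv /= andbT pmulr_rgt0.
rewrite ge0_integral_affine// muleA -EFinM; congr (_%:E * _).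
rewrite -[X in (_ * X)%R](powR_inv1 (ltW c0)) -powRD; last by rewrite (gt_eqF c0) implybT.
by congr powR; ring.
Qed.

End Mellin.

Section GammaFinite.
Context {R : realType}.
Local Notation mu := (@lebesgue_measure R).

(** The integrand may blow up at 0, so the fundamental theorem is applied on [1 / (n + 2), 1], where
    the primitive t^p changes by at most 1, and n tends to infinity. *)
Lemma integral_powR_01_le (p : R) : 0 < p ->
  (\int[mu]_(t in `]0%R, 1%R]) (p * t `^ (p - 1))%:E <= 1)%E.
Proof.
move=> p0.
pose F n := `[n.+2%:R^-1, 1%R]%classic : set R.
have FU : \bigcup_n F n = `]0%R, 1%R]%classic.
  apply/seteqP; split => x /=.
    move=> [n _]; rewrite /F /= !in_itv /= => /andP[nx x1].
    by rewrite x1 andbT (lt_le_trans _ nx)// invr_gt0.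
  rewrite in_itv /= => /andP[x0 x1]; exists (Num.truncn x^-1) => //.
  rewrite /F /= in_itv /= x1 andbT -[leRHS]invrK lef_pV2 ?posrE ?invr_gt0//.
  by apply/ltW/(lt_le_trans (truncnS_gt _)); rewrite ler_nat.
have mint (D : set R) : measurable_fun D (fun t : R => (p * t `^ (p - 1))%:E).
  apply: measurable_funTS; apply/measurable_EFinP; exact: measurable_funM.
have cF : (\int[mu]_(t in F n) (p * t `^ (p - 1))%:E @[n --> \oo] -->
    \int[mu]_(t in `]0%R, 1%R]) (p * t `^ (p - 1))%:E)%E.
  rewrite -FU; apply: ge0_nondecreasing_set_cvg_integral => //.
  - move=> m n mn; apply/subsetPset => x /=; rewrite /F /= !in_itv /= => /andP[mx x1].
    by rewrite x1 andbT (le_trans _ mx)// lef_pV2 ?posrE// ler_nat !ltnS.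
  - by move=> n; exact: measurable_itv.
  - by move=> n; exact: mint.
  - by move=> n x _; rewrite lee_fin mulr_ge0 ?powR_ge0// ltW.
rewrite -(cvg_lim _ cF)//; apply: lime_le; first by apply/cvg_ex; eexists; exact: cF.
apply: nearW => n.
have n0 : (0 : R) < n.+2%:R^-1 by rewrite invr_gt0.
have n1 : n.+2%:R^-1 < (1 : R) by rewrite invf_lt1// ltr1n.
have gt0 (x : R) : n.+2%:R^-1 <= x -> 0 < x by exact: lt_le_trans.
have contF (q x : R) : 0 < x -> {for x, continuous (fun t : R => t `^ q)}.
  move=> x0; apply/differentiable_continuous/derivable1_diffP.
  by apply: derivable_powR; rewrite in_itv /= andbT.
rewrite (continuous_FTC2 (F := fun t => t `^ p) n1).
- by rewrite powR1 -EFinB lee_fin gerBl powR_ge0.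
- apply/continuous_in_subspaceT => x; rewrite inE /= in_itv /= => /andP[nx _].
  apply: cvgM; first exact: cvg_cst.
  exact/contF/gt0.
- split.
  + move=> x; rewrite in_itv /= => /andP[nx _]; apply: derivable_powR.
    by rewrite in_itv /= andbT gt0// ltW.
  + by apply/cvg_at_right_filter/contF/gt0.
  + by apply/cvg_at_left_filter/contF.
- move=> x; rewrite in_itv /= => /andP[nx _]; apply: powR_derive1.
  by rewrite in_itv /= andbT gt0// ltW.
Qed.

Lemma integral_expRN (c : R) : 0 < c ->
  (\int[mu]_(t in `[0%R, +oo[) (expR (- c * t))%:E = c^-1%:E)%E.
Proof.
move=> c0; have := integral_exponential_pdf c0.
have -> : (\int[mu]_x (exponential_pdf c x)%:E =
    \int[mu]_(t in `[0%R, +oo[) (c%:E * (expR (- c * t))%:E))%E.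
  rewrite [RHS]integral_mkcond; apply: eq_integral => x _.
  by rewrite /exponential_pdf !patchE; case: ifP.
rewrite ge0_integralZl//; last 2 first.
- apply: measurable_funTS; apply/measurable_EFinP.
  by apply: measurableT_comp; [exact: measurable_expR|exact: measurable_funM].
- by rewrite lee_fin ltW.
by move=> H; rewrite -[LHS]mul1e -(mulVf (lt0r_neq0 c0)) EFinM -muleA H mule1.
Qed.

Lemma powR_le_expR (p : R) : exists2 C : R, 0 <= C &
  forall t, 1 <= t -> t `^ p <= C * expR (2^-1 * t).
Proof.
(* With a natural number [m] above [p], the bound t <= 2 m exp (t / (2 m)) raised to the power [m]
   yields the constant (2 m)^m and spends only half of the decay of exp (- t). *)
pose m := (Num.truncn `|p|).+1.
have pm : p <= m%:R.
  by apply: le_trans (ler_norm p) _; exact/ltW/truncnS_gt.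
exists ((2 * m%:R) ^+ m) => [|x x1]; first by rewrite exprn_ge0// mulr_ge0.
apply: (@le_trans _ _ (x `^ m%:R)); first exact: ler_powR.
have x0 : 0 < x by exact: lt_le_trans x1.
rewrite powR_mulrn; last exact: ltW.
have -> : expR (2^-1 * x) = expR (x / (2 * m%:R)) ^+ m.
  rewrite -expRM_natl; congr expR.
  have : (m%:R : R) != 0 by rewrite pnatr_eq0.
  by move: (m%:R : R) => k k0; field.
rewrite -exprMn; apply: lerXn2r.
- by rewrite nnegrE ltW.
- by rewrite nnegrE mulr_ge0 ?mulr_ge0 ?expR_ge0.
rewrite mulrC -ler_pdivrMr; last by rewrite mulr_gt0// ltr0n.
by apply: le_trans (expR_ge1Dx _); rewrite lerDr.
Qed.

End GammaFinite.

Section GammaMellin.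
Context {R : realType}.
Local Open Scope ereal_scope.
Local Notation mu := (@lebesgue_measure R).

Lemma measurable_expRN (c : R) : measurable_fun setT (fun t : R => (expR (- (c * t)))%:E).
Proof.
apply/measurable_EFinP; apply: measurableT_comp; first exact: measurable_expR.
by apply: measurable_funN; exact: measurable_funM.
Qed.

Lemma Mellin_exp_lty (p : R) : (0 < p)%R ->
  Mellin p (fun t => (expR (- t))%:E) < +oo.
Proof.
move=> p0; have [C C0 HC] := powR_le_expR (p - 1).
pose g1 (t : R) : \bar R := ((fun t => (p * t `^ (p - 1))%:E) \_ `]0%R, 1%R]) t.
pose g2 (t : R) : \bar R := ((fun t => (expR (- 2^-1 * t))%:E) \_ `[0%R, +oo[) t.
have g10 t : 0 <= g1 t.
  by rewrite /g1 patchE; case: ifP => // _; rewrite lee_fin mulr_ge0 ?powR_ge0// ltW.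
have g20 t : 0 <= g2 t.
  by rewrite /g2 patchE; case: ifP => // _; rewrite lee_fin expR_ge0.
have m1 : measurable_fun setT g1.
  apply/(measurable_restrictT _ _).1 => //; apply: measurable_funTS.
  by apply/measurable_EFinP; exact: measurable_funM.
have m2 : measurable_fun setT g2.
  apply/(measurable_restrictT _ _).1 => //; apply: measurable_funTS.
  apply/measurable_EFinP; apply: measurableT_comp; first exact: measurable_expR.
  exact: measurable_funM.
apply: (@le_lt_trans _ _ (\int[mu]_t ((p^-1)%:E * g1 t + C%:E * g2 t))).
  rewrite /Mellin [leLHS]integral_mkcond; apply: ge0_le_integral_nomeas => t.
    by rewrite patchE; case: ifP => // _; rewrite mule_ge0// lee_fin ?powR_ge0 ?expR_ge0.
  rewrite patchE; case: ifPn => [|_]; last first.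
    by rewrite adde_ge0// mule_ge0// lee_fin ?invr_ge0 ltW.
  rewrite inE /= in_itv /= andbT => t0.
  have -> : g2 t = (expR (- 2^-1 * t))%:E.
    by rewrite /g2 patchE ifT// inE /= in_itv /= andbT ltW.
  have [t1|t1] := leP t 1%R.
    have -> : g1 t = (p * t `^ (p - 1))%:E.
      by rewrite /g1 patchE ifT// inE /= in_itv /= t0.
    rewrite -!EFinM -EFinD lee_fin mulKf ?lt0r_neq0// -[leLHS]addr0 lerD//.
      by rewrite ger_pMr ?powR_gt0// -expR0 ler_expR oppr_le0 ltW.
    by rewrite mulr_ge0// expR_ge0.
  have -> : g1 t = 0.
    rewrite /g1 patchE ifF//; apply/negbTE/negP; rewrite inE /= in_itv /= => /andP[_].
    by rewrite leNgt t1.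
  rewrite mule0 add0e -!EFinM lee_fin.
  apply: le_trans (ler_wpM2r (expR_ge0 _) (HC _ (ltW t1))) _.
  by rewrite -mulrA -expRD (_ : 2^-1 * t + - t = - 2^-1 * t)%R//; lra.
rewrite ge0_integralD//=; last 4 first.
- by move=> t _; rewrite mule_ge0// lee_fin invr_ge0 ltW.
- exact: measurable_funeM.
- by move=> t _; rewrite mule_ge0// lee_fin.
- exact: measurable_funeM.
rewrite !ge0_integralZl// ?lee_fin ?invr_ge0 ?(ltW p0)//.
rewrite -!integral_mkcond integral_expRN; last by rewrite invr_gt0.
rewrite -EFinM; apply: lte_add_pinfty; last exact: ltry.
apply: (@le_lt_trans _ _ ((p^-1)%:E * 1)); last by rewrite mule1 ltry.
by apply: lee_wpmul2l; [rewrite lee_fin invr_ge0 ltW|exact: integral_powR_01_le].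
Qed.

(** [Gamma] is defined through [fine], so it represents the integral only because the latter is
    finite. *)
Lemma GammaE (p : R) : (0 < p)%R ->
  Mellin p (fun t => (expR (- t))%:E) = (Gamma p)%:E.
Proof.
move=> p0; rewrite /Gamma.
have -> : \int[mu]_(t in `]0%R, +oo[) (t `^ (p - 1) * expR (- t))%:E =
    Mellin p (fun t => (expR (- t))%:E).
  by apply: eq_integral => t _; rewrite EFinM.
rewrite fineK // ge0_fin_numE; first exact: Mellin_exp_lty.
by apply: Mellin_ge0 => t; rewrite lee_fin expR_ge0.
Qed.

Lemma Gamma_gt0 (p : R) : (0 < p)%R -> (0 < Gamma p)%R.
Proof.
move=> p0; rewrite -lte_fin -GammaE//.
(* A lower bound for the integrand on [1, 2], whatever the sign of p - 1. *)
pose k := ((2 `^ `|p - 1|)^-1 * expR (- 2))%R.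
have k0 : (0 < k)%R by rewrite mulr_gt0 ?invr_gt0 ?powR_gt0 ?expR_gt0.
apply: (@lt_le_trans _ _ (\int[mu]_(t in `[1%R, 2%R]) k%:E)).
  rewrite integral_cst//= lebesgue_measure_itv /= lte_fin ltr1n -EFinB -EFinM lte_fin.
  by rewrite mulr_gt0//; lra.
rewrite /Mellin [leLHS]integral_mkcond [leRHS]integral_mkcond.
apply: ge0_le_integral_nomeas => t; rewrite !patchE.
  by case: ifP => // _; rewrite lee_fin ltW.
case: ifPn => [|_]; last first.
  by case: ifP => // _; rewrite mule_ge0// lee_fin ?powR_ge0 ?expR_ge0.
rewrite inE /= in_itv /= => /andP[t1 t2]; have t0 : (0 < t)%R by exact: lt_le_trans t1.
rewrite ifT; last by rewrite inE /= in_itv /= t0.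
rewrite -EFinM lee_fin ler_pM ?invr_ge0 ?powR_ge0 ?expR_ge0//; last first.
  by rewrite ler_expR lerN2.
apply: (@le_trans _ _ (t `^ (- `|p - 1|)))%R.
  rewrite powRN lef_pV2 ?posrE ?powR_gt0//.
  by apply: ge0_ler_powR => //; rewrite nnegrE ltW.
by apply: ler_powR => //; rewrite lerNl -normrN ler_norm.
Qed.

Lemma Mellin_expM (p c : R) : (0 < p)%R -> (0 < c)%R ->
  Mellin p (fun t => (expR (- (c * t)))%:E) = (Gamma p * c `^ (- p))%:E.
Proof.
move=> p0 c0; rewrite (Mellin_dilate p (phi := fun t => (expR (- t))%:E))//.
  by rewrite GammaE// muleC.
by have := measurable_expRN 1; under eq_fun do rewrite mul1r.
Qed.

(** The weight is positive on ]0, +oo[, so a vanishing moment of any order forces [phi] to vanish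
    there almost everywhere. *)
Lemma Mellin_ae0 (a b : R) (phi : R -> \bar R) : measurable_fun setT phi ->
  (forall t, 0 <= phi t) -> Mellin a phi = 0 -> Mellin b phi = 0.
Proof.
move=> mphi phi0 Ma0.
have m p : measurable_fun (`]0%R, +oo[ : set R) (fun t => (t `^ (p - 1))%:E * phi t).
  exact: measurable_Mellin_integrand.
have g0 p t : 0 <= (t `^ (p - 1))%:E * phi t by rewrite mule_ge0// lee_fin powR_ge0.
have : \int[mu]_(t in `]0%R, +oo[) `|(t `^ (a - 1))%:E * phi t| = 0.
  by under eq_integral do rewrite gee0_abs//.
move=> /(ae_eq_integral_abs mu (measurable_itv _) (m a)) H.
transitivity (\int[mu]_(t in `]0%R, +oo[) cst 0 t); last exact: integral0.
apply: ge0_ae_eq_integral => //; first exact: m.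
apply: filterS H => t H t0; move: (H t0) => /eqP; rewrite mule_eq0 => /orP[|/eqP ->]; last first.
  by rewrite mule0.
move: t0; rewrite /= in_itv /= andbT => t0.
by rewrite eqe (gt_eqF (powR_gt0 _ t0)).
Qed.

(* The hypothesis on [phi] makes [(ln a - ln (phi t)) / t] nondecreasing, so [phi]
   crosses [a * exp (- c t)] at most once, from above to below; at the crossing
   point [t0] the weight [t^(b-a) - t0^(b-a)] changes sign too. *)
Lemma Mellin_le_exp (al be a c : R) (phi : R -> R) :
  (0 < al)%R -> (al < be)%R -> (0 < a)%R -> (0 < c)%R ->
  measurable_fun setT phi -> (forall t, 0 <= phi t)%R ->
  (forall s t : R, 0 < s < 1 -> 0 < t -> a `^ (1 - s) * phi t `^ s <= phi (s * t))%R ->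
  Mellin al (fun t => (phi t)%:E) = (a * Gamma al * c `^ (- al))%:E ->
  Mellin be (fun t => (phi t)%:E) <= (a * Gamma be * c `^ (- be))%:E.
Proof.
move=> al0 albe a0 c0 mphi phi0 phi_cvx Mal.
have be0 : (0 < be)%R by exact: lt_trans albe.
pose E (t : R) : R := (a * expR (- (c * t)))%R.
have mE : measurable_fun setT (fun t => (E t)%:E).
  rewrite /E; under eq_fun do rewrite EFinM.
  by apply: emeasurable_funM => //; exact: measurable_expRN.
have E0 t : (0 <= E t)%R by rewrite mulr_ge0 ?expR_ge0// ltW.
have ME (p : R) : (0 < p)%R -> Mellin p (fun t => (E t)%:E) = (a * Gamma p * c `^ (- p))%:E.
  move=> p0; under [LHS]eq_Mellin do rewrite /E EFinM.
  rewrite MellinZ//; first by rewrite Mellin_expM// -EFinM mulrA.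
  - exact: measurable_expRN.
  - by rewrite lee_fin ltW.
have mphi' : measurable_fun setT (fun t => (phi t)%:E) by exact/measurable_EFinP.
rewrite -ME//.
(* By the convexity hypothesis [S] is an initial segment of ]0, +oo[: this is the single
   crossing. *)
pose S := [set t : R | 0 < t /\ E t <= phi t]%R.
have S_down (s t : R) : S t -> (0 < s < t)%R -> S s.
  move=> [t0 Et] /andP[s0 st]; split => //.
  have st1 : (0 < s / t < 1)%R by rewrite divr_gt0//= ltr_pdivrMr// mul1r.
  have := phi_cvx _ _ st1 t0; rewrite divfK ?lt0r_neq0//; apply: le_trans.
  apply: (@le_trans _ _ (a `^ (1 - s / t) * E t `^ (s / t))%R); last first.
    apply: ler_wpM2l; first exact: powR_ge0.
    by apply: ge0_ler_powR; rewrite ?nnegrE//; case/andP: st1 => /ltW.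
  rewrite /E powRM ?expR_ge0 ?(ltW a0)// mulrA -powRD ?subrK; last first.
    by rewrite (gt_eqF a0) implybT.
  rewrite powRr1 ?(ltW a0)// -expRM (_ : - (c * t) * (s / t) = - (c * s))%R//.
  by field; exact: lt0r_neq0.
(* If [S] is unbounded, [phi] dominates the exponential everywhere; as their finite moments of order
   [al] agree, the excess [D] is null. *)
have [[u Su]|nub] := pselect (has_ubound S); last first.
  have ES (t : R) : (0 < t)%R -> (E t <= phi t)%R.
    move=> t0; apply: contrapT => nE; apply: nub; exists t => s Ss.
    rewrite leNgt; apply/negP => ts; apply: nE.
    by have [] : S t by apply: S_down Ss _; rewrite t0.
  pose D (t : R) : R := Num.max 0%R (phi t - E t)%R.
  have D0 t : (0 <= D t)%R by rewrite /D le_max lexx.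
  have mD : measurable_fun setT (fun t => (D t)%:E).
    apply/measurable_EFinP; apply: measurable_maxr => //; apply: measurable_funB => //.
    exact/measurable_EFinP.
  have phiED (p : R) : (0 < p)%R -> Mellin p (fun t => (phi t)%:E) =
      Mellin p (fun t => (E t)%:E) + Mellin p (fun t => (D t)%:E).
    move=> p0; rewrite /Mellin -ge0_integralD//; first last.
    - exact: measurable_Mellin_integrand.
    - by move=> t _; rewrite mule_ge0// lee_fin ?powR_ge0.
    - exact: measurable_Mellin_integrand.
    - by move=> t _; rewrite mule_ge0// lee_fin ?powR_ge0.
    apply: eq_integral => t; rewrite inE /= in_itv /= andbT => t0.
    rewrite -ge0_muleDr ?lee_fin// -EFinD /D max_r ?subr_ge0 ?ES//.
    by congr (_ * _%:E); rewrite addrC subrK.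
  rewrite phiED// (@Mellin_ae0 al be (fun t => (D t)%:E)) ?adde0//.
  have := phiED al al0; rewrite Mal ME//.
  case: (Mellin al (fun t => (D t)%:E)) => [d| |]// [] /eqP.
  by rewrite addrC -subr_eq subrr eq_sym => /eqP ->.
(* Adjoining 0 gives t0 = 0 when [S] is empty. *)
pose t0 := sup (S `|` [set 0%R]).
have supS : has_sup (S `|` [set 0%R]).
  split; first by exists 0%R; right.
  by exists (Num.max u 0%R) => t [/Su tu|->]; rewrite le_max ?tu ?lexx ?orbT.
have t00 : (0 <= t0)%R by apply: ub_le_sup; [case: supS|right].
have below (t : R) : (0 < t < t0)%R -> (E t <= phi t)%R.
  move=> /andP[tp tt0].
  have [s Ss] := @sup_adherent _ _ (t0 - t)%R (ltac:(by rewrite subr_gt0)) supS.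
  rewrite -/t0 subKr => ts; case: Ss => [Ss|s0]; last by move: ts; rewrite s0 ltNge ltW.
  by have [] : S t by apply: S_down Ss _; rewrite tp.
have above (t : R) : (0 < t)%R -> (t0 < t)%R -> (phi t <= E t)%R.
  move=> tp tt0; rewrite leNgt; apply/negP => Elt.
  have : (t <= t0)%R by apply: ub_le_sup; [case: supS|left; split => //; exact: ltW].
  by rewrite leNgt tt0.
pose k := (t0 `^ (be - al))%R.
have k0 : (0 <= k)%R by exact: powR_ge0.
have pw (t : R) : (0 < t)%R -> (t `^ (be - 1) * phi t + k * (t `^ (al - 1) * E t) <=
    t `^ (be - 1) * E t + k * (t `^ (al - 1) * phi t))%R.
  move=> tp; have -> : (t `^ (be - 1) = t `^ (al - 1) * t `^ (be - al))%R.
    rewrite -powRD; last by rewrite (gt_eqF tp) implybT.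
    by congr powR; ring.
  rewrite -subr_ge0 (_ : _ - _ = t `^ (al - 1) * ((t `^ (be - al) - k) * (E t - phi t)))%R; last by ring.
  apply: mulr_ge0; first exact: powR_ge0.
  have ba : (0 <= be - al)%R by rewrite subr_ge0 ltW.
  have [tt0|tt0|->] := ltgtP t t0.
  - rewrite mulr_le0//; last by rewrite subr_le0 below// tp.
    by rewrite subr_le0 /k; apply: ge0_ler_powR; rewrite ?nnegrE// ltW.
  - rewrite mulr_ge0//; last by rewrite subr_ge0 above.
    by rewrite subr_ge0 /k; apply: ge0_ler_powR; rewrite ?nnegrE// ltW.
  - by rewrite /k subrr mul0r.
have MD (v w : R -> R) : (forall t, 0 <= v t)%R -> (forall t, 0 <= w t)%R ->
    measurable_fun setT (fun t => (v t)%:E) -> measurable_fun setT (fun t => (w t)%:E) ->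
    Mellin be (fun t => (v t)%:E) + k%:E * Mellin al (fun t => (w t)%:E) =
    \int[mu]_(t in `]0%R, +oo[) (t `^ (be - 1) * v t + k * (t `^ (al - 1) * w t))%:E.
  move=> v0 w0 mv mw; rewrite /Mellin.
  have g0 (p : R) (z : R -> R) : (forall t, 0 <= z t)%R ->
      forall t, `]0%R, +oo[%classic t -> 0 <= (t `^ (p - 1))%:E * (z t)%:E.
    by move=> z0 t _; rewrite mule_ge0// lee_fin ?powR_ge0.
  have m p (z : R -> R) : measurable_fun setT (fun t => (z t)%:E) ->
      measurable_fun (`]0%R, +oo[%classic : set R) (fun t => (t `^ (p - 1))%:E * (z t)%:E).
    by move=> mz; exact: measurable_Mellin_integrand.
  rewrite -(ge0_integralZl mu (measurable_itv _) (m al w mw) (g0 al w w0)); last first.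
    by rewrite lee_fin.
  rewrite -ge0_integralD//; first last.
  - by apply: measurable_funeM; exact: m.
  - by move=> t tp; rewrite mule_ge0 ?g0.
  - exact: m.
  - exact: g0.
(* The inequality is kept as a comparison of sums, since the moment of [phi] of order [be] is not
   yet known to be finite; the two moments of order [al] are equal and finite, and cancel. *)
have : Mellin be (fun t => (phi t)%:E) + k%:E * Mellin al (fun t => (E t)%:E) <=
    Mellin be (fun t => (E t)%:E) + k%:E * Mellin al (fun t => (phi t)%:E).
  rewrite !MD//; rewrite integral_mkcond [leRHS]integral_mkcond.
  apply: ge0_le_integral_nomeas => t; rewrite !patchE; case: ifPn => //.
    move=> _; rewrite lee_fin addr_ge0//.
    - exact: mulr_ge0 (powR_ge0 _ _) (phi0 _).
    - exact: mulr_ge0 k0 (mulr_ge0 (powR_ge0 _ _) (E0 _)).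
  by rewrite inE /= in_itv /= andbT => tp; rewrite lee_fin pw.
by rewrite Mal ME// -EFinM leeD2rE.
Qed.

End GammaMellin.

(** * Comparison along rays *)

Section Polar.
Context {R : realType}.
Local Open Scope ereal_scope.
Local Notation mu := (@lebesgue_measure R).

Lemma coord_measurableZ d (T : measurableType d) n (s : T -> R) (u : T -> 'rV[R]_n) :
  measurable_fun setT s -> coord_measurable u ->
  coord_measurable (fun t => s t *: u t)%R.
Proof.
by move=> ms mu_ i; under eq_fun do rewrite mxE; exact: measurable_funM.
Qed.

Lemma coord_measurableD d (T : measurableType d) n (u v : T -> 'rV[R]_n) :
  coord_measurable u -> coord_measurable v ->
  coord_measurable (fun t => u t + v t)%R.
Proof.
by move=> mu_ mv i; under eq_fun do rewrite mxE; exact: measurable_funD.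
Qed.

Lemma coord_measurable_cst d (T : measurableType d) n (x : 'rV[R]_n) :
  coord_measurable (fun=> x : 'rV[R]_n) (T := T).
Proof. by move=> i; exact: measurable_cst. Qed.

Lemma Bor_ray_param n (F : 'rV[R]_n -> \bar R) :
  Bor F -> Bor_param (fun (t : R) x => F (t *: x)%R).
Proof. by move=> BF d T s u ms mu_; apply: BF; exact: coord_measurableZ. Qed.

Lemma measurable_ray n (F : 'rV[R]_n -> \bar R) x :
  Bor F -> measurable_fun setT (fun t : R => F (t *: x)%R).
Proof.
by move=> BF; apply: (Bor_ray_param BF (s := id) (u := fun=> x)) => // i.
Qed.

Lemma MellinE p (phi : R -> \bar R) :
  Mellin p phi = \int[mu]_t ((\1_(`]0%R, +oo[%classic : set R) t * t `^ (p - 1))%:E * phi t).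
Proof.
rewrite /Mellin integral_mkcond; apply: eq_integral => t _.
by rewrite patchE indicE; case: ifP => _; rewrite ?mul1r// mul0r mul0e.
Qed.

Lemma Bor_param_Mellin n (K : R -> 'rV[R]_n -> \bar R) p : Bor_param K ->
  Bor_param (fun t x => (\1_(`]0%R, +oo[%classic : set R) t * t `^ (p - 1))%:E * K t x).
Proof.
move=> BK d T s u ms mu_; apply: emeasurable_funM; last exact: BK.
apply/measurable_EFinP.
apply: (measurableT_comp (f := fun t => \1_(`]0%R, +oo[%classic : set R) t * t `^ (p - 1))%R) => //.
exact: measurable_funM.
Qed.

Lemma Mellin_integrand_ge0 p (t : R) (c : \bar R) : 0 <= c ->
  0 <= (\1_(`]0%R, +oo[%classic : set R) t * t `^ (p - 1))%:E * c.
Proof. by move=> c0; rewrite mule_ge0// lee_fin mulr_ge0// powR_ge0. Qed.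

Lemma Bor_Mellin n (K : R -> 'rV[R]_n -> \bar R) p : Bor_param K ->
  (forall t x, 0 <= K t x) -> Bor (fun x => Mellin p (K ^~ x)).
Proof.
move=> BK K0; under eq_fun do rewrite MellinE.
apply: (@Bor_integral _ _ _ mu _
  (fun t x => (\1_(`]0%R, +oo[%classic : set R) t * t `^ (p - 1))%:E * K t x)).
  exact: Bor_param_Mellin.
by move=> t x; exact: Mellin_integrand_ge0.
Qed.

Lemma intRn_Mellin n (K : R -> 'rV[R]_n -> \bar R) p : Bor_param K ->
  (forall t x, 0 <= K t x) ->
  intRn (fun x => Mellin p (K ^~ x)) = Mellin p (fun t => intRn (K t)).
Proof.
move=> BK K0; under eq_intRn do rewrite MellinE.
rewrite -(@intRn_integral _ _ _ mu _
  (fun t x => (\1_(`]0%R, +oo[%classic : set R) t * t `^ (p - 1))%:E * K t x)).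
- rewrite MellinE; apply: eq_integral => t _; rewrite intRnZl//.
  + exact: Bor_paramE.
  + by rewrite lee_fin mulr_ge0// powR_ge0.
- exact: Bor_param_Mellin.
- by move=> t x; exact: Mellin_integrand_ge0.
Qed.

(** Any weight whose integral against dt / t is positive and finite would serve; here that integral
    is ln 2. *)
Definition shell (u : R) : \bar R := (\1_(`]2^-1%R, 1%R]%classic : set R) u)%:E.

Lemma measurable_shell : measurable_fun setT shell.
Proof.
apply/measurable_EFinP.
exact: (@measurable_indic _ _ R setT _ (measurable_itv _)).
Qed.

Lemma shell_ge0 u : 0 <= shell u. Proof. by rewrite lee_fin. Qed.

Lemma shellE u : shell u = if (2^-1 < u <= 1)%R then 1 else 0.
Proof.
rewrite /shell indicE; case: ifPn => u1.
  by rewrite mem_set //= in_itv.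
by rewrite memNset //= in_itv /=; exact/negP.
Qed.

Lemma indic_itv0yE (u : R) : \1_(`]0%R, +oo[%classic : set R) u = (0 < u)%R%:R :> R.
Proof.
rewrite indicE; congr (_%:R); have [u0|u0] := boolP (0 < u)%R.
  by rewrite mem_set //= in_itv /= u0.
by rewrite memNset //= in_itv /= (negbTE u0).
Qed.

Lemma Mellin0_shell : exists2 k : R, (0 < k)%R & Mellin 0 shell = k%:E.
Proof.
have half : (0 < 2^-1 :> R)%R by rewrite invr_gt0.
have M0 : 0 < Mellin 0 shell.
  apply: (@lt_le_trans _ _ (\int[mu]_(t in `]2^-1%R, 1%R]) 1)).
    rewrite integral_cst//= mul1e lebesgue_measure_itv /= lte_fin ifT ?invf_lt1 ?ltr1n//.
    by rewrite -EFinB lte_fin subr_gt0 invf_lt1 ?ltr1n.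
  rewrite MellinE [leLHS]integral_mkcond; apply: ge0_le_integral_nomeas => t; rewrite patchE.
    by case: ifP.
  rewrite shellE indic_itv0yE; case: ifPn => [|/negP]; rewrite inE /= in_itv /=; last first.
    by move=> /negP/negbTE ->; rewrite mule0.
  move=> /[dup] t21 /andP[t2 t1]; rewrite t21.
  have t0 : (0 < t)%R by exact: lt_trans t2.
  rewrite t0 mul1r mule1 lee_fin sub0r powR_inv1 ?(ltW t0)//.
  by rewrite invf_ge1.
have Moo : Mellin 0 shell <= 2%:E.
  apply: (@le_trans _ _ (\int[mu]_(t in `]2^-1%R, 1%R]) 2%:E)).
    rewrite MellinE [leRHS]integral_mkcond; apply: ge0_le_integral_nomeas => t.
      exact/Mellin_integrand_ge0/shell_ge0.
    rewrite patchE; case: ifPn => [|/negP]; rewrite inE /= in_itv /= shellE indic_itv0yE; last first.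
      by move=> /negP/negbTE ->; rewrite mule0.
    move=> /[dup] t21 /andP[t2 t1]; rewrite t21.
    have t0 : (0 < t)%R by exact: lt_trans t2.
    rewrite t0 mul1r mule1 lee_fin sub0r powR_inv1 ?(ltW t0)//.
    by rewrite -[leRHS]invrK lef_pV2 ?posrE ?invr_gt0// ltW.
  rewrite integral_cst//= lebesgue_measure_itv /= lte_fin ifT ?invf_lt1 ?ltr1n//.
  by rewrite -EFinB -EFinM lee_fin; lra.
move: M0 Moo; case: (Mellin 0 shell) => [k k0 _| |]//.
by exists k.
Qed.

Lemma eq_integral_neq0 (f g : R -> \bar R) : measurable_fun setT f ->
  measurable_fun setT g -> (forall x, x != 0%R -> f x = g x) ->
  \int[mu]_x f x = \int[mu]_x g x.
Proof.
move=> mf mg fg; have m0 : measurable ([set: measurableTypeR R] `\ 0%R).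
  by apply: measurableD.
rewrite -(@integral_setD1 _ f 0%R)//; last exact: measurable_funTS.
rewrite -(@integral_setD1 _ g 0%R)//; last exact: measurable_funTS.
by apply: eq_integral => x; rewrite inE /= => -[_ /eqP]; exact: fg.
Qed.

(* Integrating the shell weight [shell (1 / |x_0|)] along rays is the substitute for
   polar coordinates: the left-hand side only depends on the radial moments of [F]. *)
Lemma intRn_shell_Mellin m (F : 'rV[R]_m.+1 -> \bar R) : Bor F -> (forall x, 0 <= F x) ->
  intRn (fun x => Mellin m.+1%:R (fun t => shell (`|x ord0 ord0|^-1) * F (t *: x)%R)) =
  Mellin 0 shell * intRn F.
Proof.
move=> BF F0.
have shell_meas d (T : measurableType d) (v : T -> R) :
    measurable_fun setT v -> measurable_fun setT (fun t => shell (v t)).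
  by move=> mv; exact: (measurableT_comp measurable_shell).
have mabsV d (T : measurableType d) (v : T -> R) :
    measurable_fun setT v -> measurable_fun setT (fun t => `|v t|^-1)%R.
  move=> mv; rewrite (_ : (fun t => _) = (fun a : R => a `^ (-1))%R \o (@Num.norm R R \o v)); last first.
    by apply/funext => t /=; rewrite powR_inv1.
  have mn := measurableT_comp (@normr_measurable R setT) mv.
  exact: (measurableT_comp (measurable_powR (-1)%R) mn).
have BK : Bor_param (fun (t : R) (x : 'rV[R]_m.+1) => shell (`|x ord0 ord0|^-1) * F (t *: x)%R).
  move=> d T s u ms mu_; apply: emeasurable_funM.
    by apply: shell_meas; exact: mabsV.
  by apply: BF; exact: coord_measurableZ.
have BK' : Bor_param (fun (t : R) (x : 'rV[R]_m.+1) => shell (t * `|x ord0 ord0|^-1)%R * F x).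
  move=> d T s u ms mu_; apply: emeasurable_funM; last exact: BF.
  by apply: shell_meas; apply: measurable_funM => //; exact: mabsV.
rewrite (intRn_Mellin (K := fun t x => shell (`|x ord0 ord0|^-1) * F (t *: x)%R))//; last first.
  by move=> t x; rewrite mule_ge0 ?shell_ge0.
(* Substituting x / t for x brings out t^-(m + 1) and lowers the order from m + 1 to 0, that is, to
   the scale-invariant measure dt / t. *)
transitivity (Mellin 0 (fun t => intRn (fun x : 'rV[R]_m.+1 => shell (t * `|x ord0 ord0|^-1)%R * F x))).
  rewrite /Mellin; apply: eq_integral => t /set_mem t0.
  have {}t0 : (0 < t)%R by move: t0; rewrite /= in_itv /= andbT.
  have H := @intRn_affine _ _ (fun x : 'rV[R]_m.+1 => shell (t * `|x ord0 ord0|^-1)%R * F x) t 0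
    (Bor_paramE t BK') (fun x => mule_ge0 (shell_ge0 _) (F0 _)) t0.
  have -> : intRn (fun x : 'rV[R]_m.+1 => shell (`|x ord0 ord0|^-1) * F (t *: x)%R) =
      (t ^- m.+1)%:E * intRn (fun x : 'rV[R]_m.+1 => shell (t * `|x ord0 ord0|^-1)%R * F x).
    rewrite -H; apply: eq_intRn => x; rewrite addr0 mxE normrM (gtr0_norm t0).
    by rewrite invfM mulrA mulfV ?mul1r// lt0r_neq0.
  rewrite muleA -EFinM -powR_mulrn ?(ltW t0)// -powRN -powRD; last first.
    by rewrite (gt_eqF t0) implybT.
  by congr ((powR t _)%:E * _); ring.
rewrite -(intRn_Mellin (K := fun t (x : 'rV[R]_m.+1) => shell (t * `|x ord0 ord0|^-1)%R * F x))//; last first.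
  by move=> t x; rewrite mule_ge0 ?shell_ge0.
rewrite -intRnZl//; last by apply: Mellin_ge0 => t; exact: shell_ge0.
(* On the slice x_0 = 0 the inverse is 0 by convention, so [shell] vanishes and the identity can
   fail, but the slice is null. On the others the invariance of dt / t absorbs |x_0|. *)
rewrite !intRnS; apply: eq_integral_neq0.
- apply: (measurable_intRn (f := fun x y => Mellin 0 (fun t =>
    shell (t * `|cons_rV x y ord0 ord0|^-1)%R * F (cons_rV x y)))); last first.
    by move=> x y; apply: Mellin_ge0 => t; rewrite mule_ge0 ?shell_ge0.
  move=> d T s u ms mu_; apply: (Bor_Mellin 0 BK').
    by move=> t x; rewrite mule_ge0 ?shell_ge0.
  exact: coord_measurable_cons.
- apply: (measurable_intRn (f := fun x y => Mellin 0 shell * F (cons_rV x y))).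
    move=> d T s u ms mu_; apply: measurable_funeM; apply: BF.
    exact: coord_measurable_cons.
  by move=> x y; apply: mule_ge0 => //; apply: Mellin_ge0 => t; exact: shell_ge0.
move=> x x0; apply: eq_intRn => y; rewrite cons_rV0.
have ax0 : (0 < `|x|^-1)%R by rewrite invr_gt0 normr_gt0.
under eq_Mellin do rewrite muleC [(_ * `|x|^-1)%R]mulrC.
rewrite MellinZ; [|by apply: shell_meas; exact: measurable_funM|by move=> t; exact: shell_ge0|exact: F0].
rewrite (Mellin_dilate 0 measurable_shell shell_ge0 ax0).
by rewrite oppr0 powRr0 mul1e muleC.
Qed.

(** The shell identity applied to both functions: its left-hand side is monotone in the ray moments,
    and the factor [Mellin 0 shell] can be cancelled. *)
Lemma le_intRn_radial m (F E : 'rV[R]_m.+1 -> \bar R) : Bor F -> Bor E ->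
  (forall x, 0 <= F x) -> (forall x, 0 <= E x) ->
  (forall x, Mellin m.+1%:R (fun t => F (t *: x)%R) <=
             Mellin m.+1%:R (fun t => E (t *: x)%R)) ->
  intRn F <= intRn E.
Proof.
move=> BF BE F0 E0 FE; have [k k0 kE] := Mellin0_shell.
rewrite -(@lee_pmul2l _ k%:E) ?lte_fin// -kE -!intRn_shell_Mellin//.
apply: le_intRn => x; first by apply: Mellin_ge0 => t; rewrite mule_ge0 ?shell_ge0.
rewrite !MellinZ//; do ?[exact: measurable_ray | exact: shell_ge0].
by apply: lee_wpmul2l; [exact: shell_ge0|exact: FE].
Qed.

End Polar.

Section RadialExponential.
Context {R : realType}.
Local Open Scope ereal_scope.
Local Notation mu := (@lebesgue_measure R).

(** The layer-cake formula exp (- c) = int_c^oo exp (- s) ds. *)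
Lemma Mellin1_exp_tail (c : R) : (0 <= c)%R ->
  Mellin 1 (fun s => (expR (- s))%:E * (if (c <= s)%R then 1 else 0)) = (expR (- c))%:E.
Proof.
move=> c0; pose h (s : R) : \bar R := if (c <= s)%R then (expR (- s))%:E else 0.
have mh : measurable_fun setT h.
  apply: measurable_fun_ifT => //.
  - exact: measurable_fun_ler.
  - by have := @measurable_expRN R 1; under eq_fun do rewrite mul1r.
have h0 s : 0 <= h s by rewrite /h; case: ifP => // _; rewrite lee_fin expR_ge0.
transitivity (\int[mu]_s h s).
  rewrite MellinE; apply: eq_integral_neq0 => //.
    apply: emeasurable_funM.
      apply/measurable_EFinP; apply: measurable_funM => //.
    apply: emeasurable_funM.
      by have := @measurable_expRN R 1; under eq_fun do rewrite mul1r.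
    by apply: measurable_fun_ifT => //; exact: measurable_fun_ler.
  move=> s s0; rewrite indic_itv0yE subrr powRr0 mulr1 /h.
  case: ifPn => cs; last by rewrite !mule0.
  by rewrite mule1 lt_neqAle eq_sym s0 (le_trans c0 cs) mul1e.
have := @ge0_integral_affine R 1 c h ltr01 mh h0; rewrite invr1 mul1e => <-.
transitivity (\int[mu]_s ((expR (- c))%:E * ((fun s => (expR (- 1 * s))%:E) \_ `[0%R, +oo[) s)).
  apply: eq_integral => s _; rewrite mul1r /h patchE lerDr.
  have [s0|s0] := leP 0%R s.
    by rewrite ifT ?inE /= ?in_itv /= ?s0// -EFinM -expRD mulN1r opprD addrC.
  by rewrite ifF ?mule0//; apply/negP; rewrite inE /= in_itv /= andbT leNgt s0.
rewrite ge0_integralZl//.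
- by rewrite -integral_mkcond integral_expRN// invr1 mule1.
- apply/(measurable_restrictT _ _).1 => //; apply: measurable_funTS.
  have := @measurable_expRN R 1; apply: eq_measurable_fun => s _.
  by rewrite mulNr.
- by move=> s _; rewrite patchE; case: ifP => // _; rewrite lee_fin expR_ge0.
Qed.

(** A constant is invariant under dilation by 2, so the value M satisfies M = 2^(-p) M; being at
    least Gamma(p) > 0, it is infinite. *)
Lemma Mellin_cst1 (p : R) : (0 < p)%R -> Mellin p (cst 1) = +oo.
Proof.
move=> p0.
have M0 : 0 < Mellin p (cst (1 : \bar R)).
  apply: (@lt_le_trans _ _ (Gamma p)%:E); first by rewrite lte_fin Gamma_gt0.
  rewrite -GammaE//; apply: le_Mellin => t; first by rewrite lee_fin expR_ge0.
  by move=> t0; rewrite lee_fin -expR0 ler_expR oppr_le0 ltW.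
have E : Mellin p (cst (1 : \bar R)) = (2 `^ - p)%:E * Mellin p (cst 1).
  exact: (@Mellin_dilate R p (cst 1) 2 (measurable_cst _) (fun=> lee01) (ltr0Sn _ _)).
have lt1 : (2 `^ (- p) < 1 :> R)%R.
  rewrite powRN invf_lt1 ?powR_gt0//.
  have := @gt0_ltr_powR R p p0 1%R 2%R.
  by rewrite powR1; apply; rewrite ?nnegrE ?ltr1n.
move: M0 E; case: (Mellin p (cst 1)) => [r r0 [] rE| |]//.
have : (2 `^ (- p) * r < r)%R by rewrite gtr_pMl.
by rewrite -rE ltxx.
Qed.

Context (m : nat) (al a : R) (F : 'rV[R]_m.+1 -> \bar R).
Hypotheses (al0 : (0 < al)%R) (al_lt : (al < m.+1%:R)%R) (a0 : (0 < a)%R).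
Hypotheses (BF : Bor F) (F0 : forall x, 0 <= F x).

(** For [F = corr f] and x nonzero this is the gauge of x in H_alpha f to the power [- al], hence
    the homogeneity in [radialZ]. *)
Definition radial (x : 'rV[R]_m.+1) : \bar R := Mellin al (fun t => F (t *: x)%R).

Lemma radial_ge0 x : 0 <= radial x. Proof. exact: Mellin_ge0. Qed.

Lemma Bor_radial : Bor radial.
Proof. by apply: (Bor_Mellin al (K := fun t x => F (t *: x)%R)) => //; exact: Bor_ray_param. Qed.

Lemma radialZ (s : R) x : (0 < s)%R -> radial (s *: x) = (s `^ - al)%:E * radial x.
Proof.
move=> s0; rewrite /radial -(Mellin_dilate al (measurable_ray x BF))//.
by apply: eq_Mellin => t _; rewrite scalerA mulrC.
Qed.

Definition radial_level (c : R) : set 'rV[R]_m.+1 := [set x | c%:E <= radial x].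

Lemma Bor_indic_radial (c : R) : Bor (fun x => (\1_(radial_level c) x)%:E).
Proof.
move=> d T u mu_; apply/measurable_EFinP.
have -> : (fun t => \1_(radial_level c) (u t)) =
    (\1_[set t : T | c%:E <= radial (u t)] : T -> R).
  by apply/funext => t; rewrite !indicE; congr (_%:R); apply/idP/idP; rewrite !inE.
apply: measurable_indic; rewrite -[X in measurable X]setTI; apply: measurable_lee => //.
exact: Bor_radial.
Qed.

(* On each ray this is [a * exp (- c t)], where [c] is chosen such that it has the
   same Mellin transform at [al] as [F]; the layer-cake form avoids dividing by
   radial functions that vanish or are infinite. *)
Definition radial_exp (x : 'rV[R]_m.+1) : \bar R :=
  a%:E * Mellin 1 (fun s => (expR (- s))%:E * (\1_(radial_level (a * Gamma al)) (s `^ (-1) *: x)%R)%:E).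

Let K (s : R) (x : 'rV[R]_m.+1) : \bar R :=
  (expR (- s))%:E * (\1_(radial_level (a * Gamma al)) (s `^ (-1) *: x)%R)%:E.

Let BK : Bor_param K.
Proof.
move=> d T s u ms mu_; apply: emeasurable_funM.
  have := @measurable_expRN R 1; under eq_fun do rewrite mul1r.
  by move=> me; exact: (measurableT_comp me ms).
apply: (Bor_indic_radial (a * Gamma al)); apply: coord_measurableZ => //.
exact: (measurableT_comp (measurable_powR (-1)%R) ms).
Qed.

Let K0 s x : 0 <= K s x.
Proof. by rewrite mule_ge0// lee_fin ?expR_ge0. Qed.

Lemma radial_exp_ge0 x : 0 <= radial_exp x.
Proof.
by rewrite mule_ge0 ?lee_fin ?(ltW a0)//; apply: Mellin_ge0 => s; exact: K0.
Qed.

Lemma Bor_radial_exp : Bor radial_exp.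
Proof.
have BM := Bor_Mellin 1 BK K0.
by move=> d T u mu_; apply: measurable_funeM; exact: BM.
Qed.

(** The layer at height s is the level set dilated by s, of volume s^(m + 1) times that of the level
    set; integrating against exp (- s) gives Gamma(m + 2). *)
Lemma intRn_radial_exp : intRn radial_exp =
  (a * Gamma m.+2%:R)%:E * intRn (fun x => (\1_(radial_level (a * Gamma al)) x)%:E).
Proof.
rewrite intRnZl//; last 3 first.
- exact: Bor_Mellin.
- by move=> x; apply: Mellin_ge0 => s; exact: K0.
- by rewrite lee_fin ltW.
rewrite (intRn_Mellin 1 BK K0) EFinM -muleA; congr (_ * _).
set V := intRn (fun x => (\1_(radial_level (a * Gamma al)) x)%:E).
have V0 : 0 <= V by apply: intRn_ge0 => x; rewrite lee_fin.
rewrite muleC -(GammaE (ltr0Sn _ _)) -MellinZ//; first last.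
- by have := @measurable_expRN R 1; under eq_fun do rewrite mul1r.
rewrite /Mellin; apply: eq_integral => s /set_mem s0.
have {}s0 : (0 < s)%R by move: s0; rewrite /= in_itv /= andbT.
have si0 : (0 < s `^ (-1))%R by rewrite powR_gt0.
have -> : intRn (K s) = (expR (- s))%:E * ((s `^ m.+1%:R)%:E * V).
  have BI := Bor_indic_radial (a * Gamma al).
  have I0 x : 0 <= (\1_(radial_level (a * Gamma al)) x)%:E :> \bar R by rewrite lee_fin.
  rewrite intRnZl; last 3 first.
  - by move=> d T u mu_; apply: BI; apply: coord_measurableZ.
  - by move=> x; exact: I0.
  - by rewrite lee_fin expR_ge0.
  congr (_ * _).
  have := @intRn_affine _ _ (fun x => (\1_(radial_level (a * Gamma al)) x)%:E) _ 0 BI I0 si0.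
  rewrite -powR_mulrn ?powR_ge0// -powRN -powRrM mulN1r opprK => <-.
  by apply: eq_intRn => x; rewrite addr0.
rewrite subrr powRr0 mul1e [in RHS]muleCA [V * _]muleC !muleA -!EFinM; congr (_%:E * _).
rewrite mulrC; congr (powR s _ * _)%R.
by rewrite -[in RHS]natr1 addrK.
Qed.

Let aG0 : (0 < a * Gamma al)%R. Proof. by rewrite mulr_gt0// Gamma_gt0. Qed.

(** The hypothesis says that [c] is the gauge of [x] with respect to the level set. *)
Lemma radial_expE (c : R) x : (0 <= c)%R ->
  (forall s, (0 < s)%R -> radial_level (a * Gamma al) (s `^ (-1) *: x)%R <-> (c <= s)%R) ->
  radial_exp x = (a * expR (- c))%:E.
Proof.
move=> c0 H; rewrite /radial_exp EFinM -Mellin1_exp_tail//; congr (_ * _).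
apply: eq_Mellin => s s0; congr (_ * _); rewrite indicE.
case: ifPn => cs; first by rewrite mem_set //; exact/H.
by rewrite memNset // => /H -/(_ s0); exact/negP.
Qed.

Lemma radial_exp_infty x : radial x = +oo -> radial_exp x = a%:E.
Proof.
move=> xoo; rewrite (radial_expE (c := 0%R))// ?oppr0 ?expR0 ?mulr1// => s s0.
split=> _; first exact: ltW.
by rewrite /radial_level /= radialZ ?powR_gt0// xoo gt0_muley ?leey// lte_fin !powR_gt0.
Qed.

Lemma radial_exp_fin (c : R) x : (0 < c)%R ->
  radial x = (a * Gamma al * c `^ (- al))%:E -> radial_exp x = (a * expR (- c))%:E.
Proof.
move=> c0 xc; apply: radial_expE => [|s s0]; first exact: ltW.
rewrite /radial_level /= radialZ ?powR_gt0// xc -EFinM lee_fin -powRrM mulN1r opprK.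
rewrite mulrCA ler_pMr// powRN ler_pdivlMr ?powR_gt0// mul1r.
split=> [|cs]; last by apply: ge0_ler_powR; rewrite ?nnegrE// ltW.
by rewrite leNgt => /negP H; rewrite leNgt; apply/negP => /(gt0_ltr_powR al0) H';
   apply: H; apply: H'; rewrite nnegrE ltW.
Qed.

Lemma intRn_le_radial_body : (forall x, F x <= a%:E) -> F 0%R = a%:E ->
  (forall s x, (0 < s < 1)%R ->
     a%:E `^ (1 - s) * F x `^ s <= F (s *: x)%R) ->
  intRn F <= (a * Gamma m.+2%:R)%:E * intRn (fun x => (\1_(radial_level (a * Gamma al)) x)%:E).
Proof.
move=> Fa F0a Fcvx; rewrite -intRn_radial_exp; apply: le_intRn_radial => //.
- exact: Bor_radial_exp.
- exact: radial_exp_ge0.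
move=> x.
have Ffin y : F y \is a fin_num by rewrite ge0_fin_numE// (le_lt_trans (Fa y))// ltry.
(* Three kinds of rays: infinite radial value, where [radial_exp] is the constant [a]; zero, where
   [F] vanishes almost everywhere; and finite positive, where the exponential comparison applies. *)
have := radial_ge0 x; case gE : (radial x) => [g| |]// g0; last first.
  apply: le_Mellin => // t t0; rewrite radial_exp_infty//.
  by rewrite radialZ// gE gt0_muley// lte_fin powR_gt0.
move: g0; rewrite lee_fin le_eqVlt => /predU1P[g0|g0].
  rewrite -g0 in gE; have -> : Mellin m.+1%:R (fun t => F (t *: x)%R) = 0.
    apply: (Mellin_ae0 (a := al)) => //; first exact: measurable_ray.
  by apply: Mellin_ge0 => t; exact: radial_exp_ge0.
(* The rate for which the moment a Gamma(al) c^(- al) of the exponential equals [g]. *)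
pose c := ((a * Gamma al / g) `^ al^-1)%R.
have c0 : (0 < c)%R by rewrite powR_gt0// divr_gt0.
have cg : (g = a * Gamma al * c `^ (- al))%R.
  rewrite /c -powRrM mulrN mulVf ?lt0r_neq0// powR_inv1 ?divr_ge0 ?(ltW g0)// ?ltW//.
  by rewrite invfM invrK mulrA mulfV ?mul1r ?lt0r_neq0.
rewrite (_ : Mellin m.+1%:R (fun t => radial_exp (t *: x)%R) =
    (a * Gamma m.+1%:R * c `^ (- m.+1%:R))%:E); last first.
  transitivity (Mellin m.+1%:R (fun t => a%:E * (expR (- (c * t)))%:E)).
    apply: eq_Mellin => t t0; rewrite (radial_exp_fin (c := (c * t)%R)) ?mulr_gt0//.
    rewrite radialZ// gE cg -EFinM; congr EFin.
    by rewrite [in RHS]powRM ?(ltW c0) ?(ltW t0)//; ring.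
  rewrite MellinZ ?lee_fin ?(ltW a0)//; last exact: measurable_expRN.
  by rewrite Mellin_expM ?ltr0Sn// -EFinM mulrA.
have E : (fun t => F (t *: x)%R) = (fun t => (fine (F (t *: x)%R))%:E).
  by apply/funext => t; rewrite fineK.
rewrite E; apply: (Mellin_le_exp (al := al)) => //.
- have := measurable_ray x BF; rewrite E => /measurable_EFinP; exact.
- by move=> t; apply: fine_ge0.
- move=> s t s01 t0; rewrite -lee_fin EFinM -!poweR_EFin !fineK//.
  by rewrite -scalerA; exact: Fcvx.
- by rewrite -E -cg.
Qed.

(** Here [F] coincides with [radial_exp] pointwise; rays with psi = 0 are those with infinite radial
    value. *)
Lemma intRn_eq_radial_body (psi : 'rV[R]_m.+1 -> R) :
  (forall x, 0 <= psi x)%R -> (forall t x, (0 < t)%R -> psi (t *: x)%R = (t * psi x)%R) ->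
  (forall x, F x = (a * expR (- psi x))%:E) ->
  intRn F = (a * Gamma m.+2%:R)%:E * intRn (fun x => (\1_(radial_level (a * Gamma al)) x)%:E).
Proof.
move=> psi0 psiZ FE; rewrite -intRn_radial_exp; apply: eq_intRn => x.
have rE : radial x = a%:E * Mellin al (fun t => (expR (- (psi x * t)))%:E).
  rewrite -MellinZ ?lee_fin ?(ltW a0)//; last exact: measurable_expRN.
  by apply: eq_Mellin => t t0; rewrite FE psiZ// [(t * _)%R]mulrC EFinM.
have := psi0 x; rewrite le_eqVlt => /predU1P[psix|psix]; last first.
  rewrite FE; apply/esym/radial_exp_fin => //.
  by rewrite rE Mellin_expM// -EFinM mulrA.
rewrite radial_exp_infty ?FE -?psix ?oppr0 ?expR0 ?mulr1//.
rewrite rE -psix; under eq_Mellin do rewrite mul0r oppr0 expR0.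
by rewrite Mellin_cst1 ?gt0_muley.
Qed.

End RadialExponential.

(** * Autocorrelation and its radial body *)

Section Correlation.
Context {R : realType}.
Local Open Scope ereal_scope.

Definition corr n (f : 'rV[R]_n -> R) (z : 'rV[R]_n) : \bar R :=
  intRn (fun x => (f x * f (x + z)%R)%:E).

Lemma intRn_translate n (g : 'rV[R]_n -> \bar R) z : Bor g -> (forall x, 0 <= g x) ->
  intRn (fun x => g (x + z)%R) = intRn g.
Proof.
move=> Bg g0; have := @intRn_affine _ _ g 1 z Bg g0 ltr01.
rewrite expr1n invr1 mul1e => <-; by apply: eq_intRn => x; rewrite scale1r.
Qed.

Section corr.
Context (n : nat) (f : 'rV[R]_n -> R).
Hypotheses (Bf : Bor (fun x => (f x)%:E)) (f0 : forall x, (0 <= f x)%R).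

Let f0e x : 0 <= (f x)%:E. Proof. by rewrite lee_fin. Qed.

Lemma Bor2_corr : Bor2 (fun z x : 'rV[R]_n => (f x * f (x + z)%R)%:E).
Proof.
move=> d T u v mu_ mv; under eq_fun do rewrite EFinM.
by apply: emeasurable_funM; apply: Bf => //; exact: coord_measurableD.
Qed.

Lemma corr_ge0 z : 0 <= corr f z.
Proof. by apply: intRn_ge0 => x; rewrite lee_fin mulr_ge0. Qed.

Lemma Bor_corr : Bor (corr f).
Proof.
by apply: (Bor_intRn Bor2_corr) => z x; rewrite lee_fin mulr_ge0.
Qed.

Let BfD z : Bor (fun x => (f (x + z)%R)%:E).
Proof.
by move=> d T u mu_; apply: Bf; apply: coord_measurableD => //; exact: coord_measurable_cst.
Qed.

Lemma intRn_corr : intRn (corr f) = intRn (fun x => (f x)%:E) * intRn (fun x => (f x)%:E).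
Proof.
rewrite /corr (exchange_intRn Bor2_corr) => [|z x]; last by rewrite lee_fin mulr_ge0.
rewrite -intRnZl//; last exact: intRn_ge0.
apply: eq_intRn => x; under eq_intRn do rewrite EFinM addrC.
rewrite intRnZl; [|exact: BfD|by move=> z; exact: f0e|exact: f0e].
by rewrite (intRn_translate (g := fun x => (f x)%:E))// muleC.
Qed.

Lemma corr0 : corr f 0 = intRn (fun x => (f x ^+ 2)%:E).
Proof. by apply: eq_intRn => x; rewrite addr0 expr2. Qed.

Lemma Bor_sqr : Bor (fun x => (f x ^+ 2)%:E).
Proof.
move=> d T u mu_; under eq_fun do rewrite expr2 EFinM.
by apply: emeasurable_funM; exact: Bf.
Qed.

(** From 2 u v <= u^2 + v^2 and translation invariance. *)
Lemma corr_le0 z : corr f z <= corr f 0.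
Proof.
have Bs := Bor_sqr.
have Bsz : Bor (fun x => (f (x + z)%R ^+ 2)%:E).
  by move=> d T u mu_; apply: Bs; apply: coord_measurableD => //; exact: coord_measurable_cst.
have s0 x : 0 <= (f x ^+ 2)%:E by rewrite lee_fin sqr_ge0.
apply: (@le_trans _ _ (intRn (fun x => 2^-1%:E * ((f x ^+ 2)%:E + (f (x + z)%R ^+ 2)%:E)))).
  apply: le_intRn => x; first by rewrite lee_fin mulr_ge0.
  rewrite -EFinD -EFinM lee_fin.
  have := sqr_ge0 (f x - f (x + z)%R); lra.
rewrite intRnZl//; last 2 first.
- by move=> d T u mu_; apply: emeasurable_funD; [exact: Bs|exact: Bsz].
- by move=> x; rewrite adde_ge0.
rewrite intRnD// (intRn_translate z Bs s0) corr0.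
case: (intRn _) (intRn_ge0 s0) => [r _|_|].
- by rewrite -EFinD -EFinM lee_fin; lra.
- exact: leey.
- by rewrite leNgt ltNyr.
Qed.

End corr.

Lemma enorm_gt0 n (x : 'rV[R]_n) : x != 0%R -> (0 < enorm x)%R.
Proof.
move=> x0; rewrite /enorm sqrtr_gt0 lt_neqAle sumr_ge0 ?andbT; last first.
  by move=> i _; exact: sqr_ge0.
apply: contra x0 => /eqP /esym s0; apply/eqP/rowP => i; rewrite mxE.
have := psumr_eq0P (fun i _ => sqr_ge0 (x ord0 i)) s0 => /(_ i isT) /eqP.
by rewrite sqrf_eq0 => /eqP.
Qed.

Section volume.
Context (m : nat) (al a : R) (f : 'rV[R]_m.+1 -> R).
Hypotheses (al0 : (0 < al)%R) (al_lt : (al < m.+1%:R)%R) (a0 : (0 < a)%R).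
Hypotheses (Bf : Bor (fun x => (f x)%:E)) (f0 : forall x, (0 <= f x)%R).
Let F := corr f.
Let BF : Bor F := Bor_corr Bf f0.
Let F0 x : 0 <= F x := corr_ge0 f0 x.

(** Homogeneity of degree [- al] absorbs the normalization by [enorm]; the origin, adjoined by hand
    in [Hset], lies in the level set because the radial value there is infinite when F(0) > 0. *)
Lemma HsetE : 0 < F 0%R -> Hset al f = radial_level al F 1.
Proof.
move=> Fa; apply/seteqP.
have H0 : radial al F 0%R = +oo.
  rewrite /radial (@eq_Mellin _ al _ (fun=> F 0%R * 1)); last first.
    by move=> t _; rewrite scaler0 mule1.
  by rewrite MellinZ ?(ltW Fa)// Mellin_cst1// gt0_muley.
have HE x : x != 0%R -> ((enorm x `^ al)%:E <= rhoH_pow al f ((enorm x)^-1 *: x)%R) =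
    (1%:E <= radial al F x).
  move=> x0; have x0' := enorm_gt0 x0.
  have -> : rhoH_pow al f ((enorm x)^-1 *: x)%R = radial al F ((enorm x)^-1 *: x)%R by [].
  rewrite radialZ ?invr_gt0// -powR_inv1 ?(ltW x0')// -powRrM mulN1r opprK.
  by rewrite -[X in X <= _]mule1 lee_pmul2l// lte_fin powR_gt0.
split => x; rewrite /Hset /radial_level /=.
  have [->|x0] := eqVneq x 0%R; first by rewrite H0 leey.
  by case=> [/eqP|]; [rewrite (negbTE x0)|rewrite HE].
by have [->|x0] := eqVneq x 0%R; [left|right; rewrite HE].
Qed.

Lemma volH_radial : 0 < F 0%R ->
  intRn (fun x => (\1_(radial_level al F (a * Gamma al)) x)%:E) =
  ((a * Gamma al) `^ (- (m.+1%:R / al)))%:E * volH al f.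
Proof.
move=> Fa; have G0 : (0 < a * Gamma al)%R by rewrite mulr_gt0// Gamma_gt0.
pose r := ((a * Gamma al) `^ al^-1)%R; have r0 : (0 < r)%R by rewrite powR_gt0.
have := @intRn_affine _ _ (fun x => (\1_(radial_level al F 1) x)%:E) r 0
  (Bor_indic_radial al BF F0 1) (fun x => ltac:(rewrite lee_fin; exact: ler0n)) r0.
have -> : (r ^- m.+1 = (a * Gamma al) `^ (- (m.+1%:R / al)))%R.
  rewrite -powR_mulrn ?(ltW r0)// -powRN /r -powRrM.
  by congr powR; rewrite mulrN mulrC.
rewrite /volH (HsetE Fa).
move=> H; apply: etrans H; apply: eq_intRn => x.
have E : radial_level al F 1 (r *: x)%R = radial_level al F (a * Gamma al) x :> Prop.
  rewrite /radial_level /mkset (radialZ al BF F0 x r0).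
  rewrite (_ : r `^ (- al) = (a * Gamma al)^-1)%R.
    by rewrite (lee_pdivlMl _ _ G0) mule1.
  by rewrite /r -powRrM mulrN (mulVf (lt0r_neq0 al0)) (powR_inv1 (ltW G0)).
have {}E : (x \in radial_level al F (a * Gamma al)) = ((r *: x)%R \in radial_level al F 1).
  by apply/idP/idP => /set_mem H; apply/mem_set; move: H; rewrite E.
by rewrite addr0 2!indicE E.
Qed.

End volume.
End Correlation.

Section MoreIntRn.
Context {R : realType}.
Local Open Scope ereal_scope.
Local Notation mu := (@lebesgue_measure R).

Lemma integral_supp1 (g : R -> \bar R) (c : R) : (forall x, 0 <= g x) ->
  (forall x, x != c -> g x = 0) -> \int[mu]_x g x = 0.
Proof.
move=> g0 gc; apply/eqP; rewrite eq_le integral_ge0 ?andbT//.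
apply: (@le_trans _ _ (\int[mu]_(x in [set c]) +oo)); last by rewrite integral_set1.
rewrite [leRHS]integral_mkcond; apply: ge0_le_integral_nomeas => // x.
rewrite patchE; have [->|xc] := eqVneq x c; first by rewrite mem_set ?leey.
by rewrite gc//; case: ifP => // _; rewrite leey.
Qed.

Lemma intRn_indic0 m : intRn (fun x : 'rV[R]_m.+1 => (\1_[set 0%R] x)%:E) = 0 :> \bar R.
Proof.
rewrite intRnS; apply: (@integral_supp1 _ 0%R).
  by move=> x; apply: intRn_ge0 => y; rewrite lee_fin.
move=> x x0; transitivity (intRn (fun _ : 'rV[R]_m => 0 * 0 : \bar R)).
  apply: eq_intRn => y; rewrite mul0e indicE memNset//= => xy.
  by move: x0; rewrite -(cons_rV0 x y) xy mxE eqxx.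
by rewrite intRnZl ?mul0e// => d T u mu_; exact: measurable_cst.
Qed.

Lemma intRn_cst1 m : intRn (fun _ : 'rV[R]_m.+1 => 1%:E) = +oo :> \bar R.
Proof.
have muT : mu setT = +oo by rewrite -set_itvNyy lebesgue_measure_itv.
have step n : 1 <= intRn (fun _ : 'rV[R]_n => 1%:E) ->
    intRn (fun _ : 'rV[R]_n.+1 => 1%:E) = +oo :> \bar R.
  move=> n1; rewrite intRnS integral_cst; last exact: measurableT.
  rewrite [X in _ * X](_ : _ = +oo); last exact: muT.
  by rewrite gt0_muley// (lt_le_trans _ n1)// lte01.
apply: (step m); elim: m => [|m IH]; first exact: lexx.
by rewrite step// leey.
Qed.

End MoreIntRn.

Arguments intRn : simpl never.

(** * The first inequality and the equality case for Borel functions *)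

Section MainBorel.
Context {R : realType}.
Local Open Scope ereal_scope.
Context (m : nat) (al : R) (f : 'rV[R]_m.+1 -> R).
Hypotheses (al0 : (0 < al)%R) (al_lt : (al < m.+1%:R)%R) (f0 : forall x, (0 <= f x)%R).

Lemma Lpn1E : Lpn f 1 = intRn (fun x => (f x)%:E).
Proof.
have -> : Lpn f 1 = poweR (intRn (fun x => (f x)%:E)) 1^-1.
  by congr poweR; apply: eq_intRn => x; rewrite ger0_norm// powRr1.
by rewrite invr1 poweRe1//; apply: intRn_ge0 => x; rewrite lee_fin.
Qed.

Lemma Lpn2E : Lpn f 2 = poweR (corr f 0%R) 2^-1.
Proof.
rewrite corr0; congr poweR; apply: eq_intRn => x.
by rewrite ger0_norm// powR_mulrn.
Qed.

Lemma lhs_H_ge0 : 0 <= lhs_H al f.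
Proof.
rewrite mule_ge0 ?poweR_ge0// lee_fin divr_ge0 ?powR_ge0// ltW//.
exact: Gamma_gt0.
Qed.

Let b : R := al / m.+1%:R.
Let b0 : (0 < b)%R. Proof. by rewrite divr_gt0. Qed.
Let b1 : (b < 1)%R. Proof. by rewrite ltr_pdivrMr// mul1r. Qed.

Section Bor_f.
Hypothesis Bf : Bor (fun x => (f x)%:E).

Lemma mid_HE : mid_H al f = poweR (corr f 0%R) (1 - b) * poweR (intRn (corr f)) b.
Proof.
rewrite /mid_H Lpn1E Lpn2E -poweRrM intRn_corr//; set I := intRn _.
have I0 : 0 <= I by apply: intRn_ge0 => x; rewrite lee_fin.
congr (poweR _ _ * _); first by rewrite mulrBr mulVf// -mulrA mulKf.
rewrite -mulrA poweRrM -/b; congr poweR; case: I I0 => [r| |]//.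
  by rewrite lee_fin => r0; rewrite poweR_EFin powR_mulrn// expr2 EFinM.
by move=> _; rewrite poweRyr ?pnatr_eq0// mulyy.
Qed.

(** The powers of [a], with exponents 1 - b, b and -1, cancel, and what remains is the constant of
    the theorem. *)
Let const_id (a : R) : (0 < a)%R ->
  (a `^ (1 - b) * ((a * Gamma m.+2%:R) * (a * Gamma al) `^ (- (m.+1%:R / al))) `^ b =
   Gamma m.+2%:R `^ b / Gamma al)%R.
Proof.
move=> a0; have G1 := Gamma_gt0 al0; have G2 : (0 < Gamma (m.+2%:R : R))%R by exact: Gamma_gt0.
rewrite !powRM ?mulr_ge0 ?powR_ge0 ?(ltW a0) ?(ltW G1) ?(ltW G2)//.
rewrite !mulrA -powRD ?subrK ?(gt_eqF a0) ?implybT// powRr1 ?(ltW a0)//.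
have e : (- (m.+1%:R / al) * b = -1)%R.
  have : (m.+1%:R != 0 :> R)%R by rewrite pnatr_eq0.
  by rewrite /b; move: (m.+1%:R : R)%R => N N0; field; rewrite N0 lt0r_neq0.
rewrite -!powRrM e !powR_inv1 ?(ltW a0) ?(ltW G1)//.
by field; rewrite !lt0r_neq0.
Qed.

(** In this form [lhs_H] differs from [mid_HE] only in the base of the last power, so inequality and
    equality both reduce to comparing [intRn (corr f)] with the volume of the level set. *)
Let lhs_eq (a : R) : (0 < a)%R -> corr f 0%R = a%:E ->
  lhs_H al f = poweR (corr f 0%R) (1 - b) * poweR
   ((a * Gamma m.+2%:R)%:E * intRn (fun x => (\1_(radial_level al (corr f) (a * Gamma al)) x)%:E)) b.
Proof.
move=> a0 fa; have aG : (0 < a * Gamma al)%R by rewrite mulr_gt0// Gamma_gt0.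
rewrite (volH_radial al0 a0 Bf f0) ?fa ?lte_fin// muleA -EFinM.
have v0 : 0 <= volH al f by apply: intRn_ge0 => x; rewrite lee_fin.
rewrite poweRM// ?lee_fin ?mulr_ge0 ?powR_ge0 ?(ltW a0) ?ltW ?Gamma_gt0//.
by rewrite muleA !poweR_EFin -EFinM const_id.
Qed.

Lemma mid_le_lhs_Bor : corr f 0%R < +oo ->
  (forall x y t, (0 < t < 1)%R -> (f x `^ (1 - t) * f y `^ t <= f ((1 - t) *: x + t *: y))%R) ->
  mid_H al f <= lhs_H al f.
Proof.
move=> foo fcvx; rewrite mid_HE.
have := corr_ge0 f0 0%R; rewrite le_eqVlt => /predU1P[fz|fpos].
  by rewrite -fz poweR0r ?mul0e ?lhs_H_ge0// subr_eq0 gt_eqF.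
have [a fa] : exists a, corr f 0%R = a%:E.
  by move: fpos foo; case: (corr f 0%R) => // a _ _; exists a.
have a0 : (0 < a)%R by move: fpos; rewrite fa lte_fin.
rewrite (lhs_eq a0 fa); apply: lee_wpmul2l; first exact: poweR_ge0.
have I0 : 0 <= intRn (fun x => (\1_(radial_level al (corr f) (a * Gamma al)) x)%:E) :> \bar R.
  by apply: intRn_ge0 => x; rewrite lee_fin.
have aG : (0 <= a * Gamma m.+2%:R)%R by rewrite mulr_ge0 ?(ltW a0)// ltW// Gamma_gt0.
apply: gt0_ler_poweR; rewrite ?(ltW b0) ?in_itv /= ?leey ?andbT//.
- exact/intRn_ge0/corr_ge0.
- by rewrite mule_ge0// lee_fin.
apply: (intRn_le_radial_body al0 al_lt a0 (Bor_corr Bf f0) (corr_ge0 f0)) => //.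
  by move=> x; rewrite -fa; exact: corr_le0.
move=> s x s01; rewrite -fa.
have Bc z : Bor (fun x => (f x * f (x + z)%R)%:E).
  move=> d T u mu_; exact: (Bor2_corr Bf (coord_measurable_cst z) mu_).
have c0 z y : 0 <= (f y * f (y + z)%R)%:E by rewrite lee_fin mulr_ge0.
(* Applied to f(u) f(u) and f(v) f(v + x), with target f(w) f(w + s x): the combination of u and v +
   x is that of u and v, moved by s x. *)
apply: (prekopa_leindler s01) => //.
move=> u v; rewrite !poweR_EFin -EFinM lee_fin !powRM// addr0.
rewrite mulrACA; apply: ler_pM; rewrite ?mulr_ge0 ?powR_ge0 ?fcvx//.
by apply: le_trans (fcvx _ _ _ s01) _; rewrite scalerDr addrA.
Qed.

Lemma mid_eq_lhs_Bor (psi : 'rV[R]_m.+1 -> R) :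
  (forall x, 0 <= psi x)%R -> (forall t x, (0 < t)%R -> psi (t *: x)%R = (t * psi x)%R) ->
  (forall x, corr f x = corr f 0%R * (expR (- psi x))%:E) ->
  lhs_H al f = mid_H al f.
Proof.
move=> psi0 psiZ fE; rewrite mid_HE.
have := corr_ge0 f0 0%R; rewrite le_eqVlt => /predU1P[fz|fpos].
  (* The correlation vanishes identically, so [Hset] shrinks to the origin and both sides are 0. *)
  rewrite -fz poweR0r ?mul0e; last by rewrite subr_eq0 gt_eqF.
  have vol0 : volH al f = 0.
    apply/eqP; rewrite eq_le; apply/andP; split; last first.
      by apply: intRn_ge0 => x; rewrite lee_fin.
    rewrite -(intRn_indic0 m); apply: le_intRn => x; first by rewrite lee_fin.
    rewrite lee_fin !indicE ler_nat.
    case: (boolP (x \in Hset al f)) => //; rewrite inE => -[->|H].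
      by rewrite mem_set.
    have [->|x0] := eqVneq x 0%R; first by rewrite mem_set.
    have H0 : rhoH_pow al f ((enorm x)^-1 *: x)%R = 0.
      transitivity (Mellin al (fun t => corr f (t *: ((enorm x)^-1 *: x)))%R) => //.
      rewrite (@eq_Mellin _ al _ (cst 0)); last first.
        by move=> t _; rewrite fE -fz mul0e.
      by rewrite /Mellin integral0_eq// => t _; rewrite mule0.
    by move: H; rewrite H0 lee_fin leNgt powR_gt0// enorm_gt0.
  by rewrite /lhs_H vol0 poweR0r ?mule0 ?lt0r_neq0.
have [fy|foo] := eqVneq (corr f 0%R) +oo.
  (* The correlation is infinite everywhere, [Hset] is the whole space, and both sides are
     infinite. *)
  have fy' x : corr f x = +oo by rewrite fE fy gt0_mulye ?lte_fin ?expR_gt0.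
  have voly : volH al f = +oo.
    rewrite -(intRn_cst1 m); apply: eq_intRn => x; rewrite indicE mem_set//.
    rewrite /Hset /=; right.
    have -> : rhoH_pow al f ((enorm x)^-1 *: x)%R = +oo; last exact: leey.
    transitivity (Mellin al (fun t => corr f (t *: ((enorm x)^-1 *: x)))%R) => //.
    rewrite (@eq_Mellin _ al _ (fun t => +oo * (cst (1 : \bar R) t))); last first.
      by move=> t _; rewrite fy' mule1.
    by rewrite MellinZ ?leey// Mellin_cst1// mulyy.
  rewrite /lhs_H voly fy !poweRyr ?lt0r_neq0 ?subr_gt0// gt0_muley; last first.
    by rewrite lte_fin divr_gt0 ?powR_gt0 ?Gamma_gt0.
  have -> : intRn (corr f) = +oo.
    apply/eqP; rewrite -leye_eq -(intRn_cst1 m); apply: le_intRn => x //.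
    by rewrite fy' leey.
  by rewrite poweRyr ?lt0r_neq0// mulyy.
have [a fa] : exists a, corr f 0%R = a%:E.
  by move: fpos foo; case: (corr f 0%R) => // a _ _; exists a.
have a0 : (0 < a)%R by move: fpos; rewrite fa lte_fin.
rewrite (lhs_eq a0 fa); congr (_ * poweR _ _).
rewrite (@intRn_eq_radial_body _ _ _ _ _ al0 a0 (Bor_corr Bf f0) (corr_ge0 f0) psi)//.
by move=> x; rewrite fE fa EFinM.
Qed.

End Bor_f.
End MainBorel.

(** * Simplices *)

Section Simplex.
Context {R : realType}.

Lemma gauge_simplex n (V : 'M[R]_n) (x : 'rV[R]_n) : V \in unitmx ->
  gauge (simplex V) x =
  (if [forall i, 0 <= (x *m invmx V) ord0 i]
   then (\sum_i (x *m invmx V) ord0 i)%:E else +oo%E).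
Proof.
move=> Vu; set c := x *m invmx V.
have SE (l : R) : (0 < l /\ [set l *: y | y in simplex V] x) <->
    [/\ 0 < l, [forall i, 0 <= c ord0 i] & \sum_i c ord0 i <= l].
  split=> [[l0 [_ [c' [c'0 [c'1 ->]] xE]]]|[l0 /forallP c0 cl]].
    have cE : c = l *: c' by rewrite /c -xE -scalemxAl mulmxK.
    split => //; first by apply/forallP => i; rewrite cE mxE mulr_ge0// ltW.
    under eq_bigr do rewrite cE mxE.
    by rewrite -mulr_sumr ger_pMr.
  split => //; exists (l^-1 *: x); last by rewrite scalerA mulfV ?scale1r// lt0r_neq0.
  exists (l^-1 *: c); split => [i|].
    by rewrite mxE mulr_ge0// invr_ge0 ltW.
  split; last by rewrite /c -scalemxAl mulmxKV.
  under eq_bigr do rewrite mxE.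
  by rewrite -mulr_sumr mulrC ler_pdivrMr// mul1r.
rewrite /gauge; case: ifPn => c0; last first.
  have -> : [set l : R | 0 < l /\ [set l *: y | y in simplex V] x] = set0.
    by apply/seteqP; split => // l /SE[_ c0' _]; rewrite c0' in c0.
  by rewrite image_set0 ereal_inf0.
have s0 : 0 <= \sum_i c ord0 i by apply: sumr_ge0 => i _; move/forallP: c0.
apply/eqP; rewrite eq_le; apply/andP; split.
  apply/lee_addgt0Pr => e e0; apply: ereal_inf_lbound.
  exists (\sum_i c ord0 i + e) => //; apply/SE; split => //; first exact: ltr_wpDl.
  by rewrite lerDl ltW.
by apply: le_ereal_inf_tmp => _ [l /SE[_ _ cl] <-]; rewrite lee_fin.
Qed.

(** One coordinate factor of [expeR (- gauge)]; the value 0 reflects the infinite gauge outside the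
    cone. *)
Definition pos_exp (s : R) : R := if 0 <= s then expR (- s) else 0.

Lemma measurable_pos_exp : measurable_fun setT pos_exp.
Proof.
apply: measurable_fun_ifT => //; first exact: measurable_fun_ler.
by apply: measurableT_comp; [exact: measurable_expR|exact: measurable_funN].
Qed.

Lemma pos_exp_ge0 s : 0 <= pos_exp s.
Proof. by rewrite /pos_exp; case: ifP => // _; exact: expR_ge0. Qed.

(** The half-lines s >= 0 and s + z >= 0 meet in s >= max (0, - z); measured from that endpoint, the
    product loses exactly the factor exp (- |z|). *)
Lemma pos_expD (s z : R) : pos_exp (s + Num.max 0 (- z)) * pos_exp (s + Num.max 0 (- z) + z) =
  expR (- `|z|) * (pos_exp s * pos_exp s).
Proof.
have [z0|z0] := leP 0 z.
  rewrite max_l ?oppr_le0// addr0 (ger0_norm z0) /pos_exp.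
  have [s0|s0] := leP 0 s; last by rewrite !mul0r mulr0.
  by rewrite addr_ge0// -!expRD; congr expR; ring.
rewrite max_r ?oppr_ge0 ?ltW// subrK (ltr0_norm z0) /pos_exp.
have [s0|s0] := leP 0 s; last by rewrite !mulr0.
by rewrite ifT -?expRD -?expRD; [congr expR; ring|lra].
Qed.

Section simplex_function.
Context (n : nat) (a : R) (x0 : 'rV[R]_n) (V : 'M[R]_n).
Hypotheses (a0 : 0 <= a) (Vu : V \in unitmx).
Let f (x : 'rV[R]_n) := a * fine (expeR (- gauge (simplex V) (x - x0))).

Lemma simplex_funE x : f x = a * \prod_i pos_exp (((x - x0) *m invmx V) ord0 i).
Proof.
rewrite /f gauge_simplex//; congr (_ * _); case: ifPn => [/forallP c0|].
  rewrite /= -sumrN expR_sum; apply: eq_bigr => i _.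
  by rewrite /pos_exp c0.
move=> /forallPn[i ci]; rewrite /= (bigD1 i)//= /pos_exp (negbTE ci).
by rewrite mul0r.
Qed.

Lemma simplex_fun_ge0 x : 0 <= f x.
Proof.
rewrite simplex_funE mulr_ge0//; apply: prodr_ge0 => i _; exact: pos_exp_ge0.
Qed.

Lemma Bor_simplex_fun : Bor (fun x => (f x)%:E).
Proof.
move=> d T u mu_; apply/measurable_EFinP.
under eq_fun do rewrite simplex_funE.
apply: measurable_funM => //; apply: measurable_prod => i _.
apply: (measurableT_comp measurable_pos_exp).
under eq_fun do rewrite mxE.
apply: measurable_sum => j; apply: measurable_funM => //.
under eq_fun do rewrite !mxE.
by apply: measurable_funB.
Qed.

Definition simplex_norm (z : 'rV[R]_n) : R := \sum_i `|(z *m invmx V) ord0 i|.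

(** The translation by [w] carries the cone onto its intersection with the translate by [- z], after
    which the integrands agree coordinate by coordinate up to exp (- |.|). *)
Lemma corr_simplex z : corr f z = (corr f 0 * (expR (- simplex_norm z))%:E)%E.
Proof.
pose w : 'rV[R]_n := (\row_i Num.max 0 (- (z *m invmx V) ord0 i)) *m V.
have Bc y : Bor (fun x => (f x * f (x + y))%:E).
  move=> d T u mu_; exact: (Bor2_corr Bor_simplex_fun (coord_measurable_cst y) mu_).
have c0 y x : (0 <= (f x * f (x + y))%:E)%E.
  by rewrite lee_fin mulr_ge0// simplex_fun_ge0.
rewrite /corr -(intRn_translate w (Bc z) (c0 z)) muleC.
rewrite -intRnZl; [|exact: Bc|exact: c0|by rewrite lee_fin expR_ge0].
apply: eq_intRn => x; rewrite addr0 -EFinM; congr EFin.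
rewrite !simplex_funE.
rewrite mulrACA [in RHS](mulrACA a) [RHS]mulrCA; congr (_ * _).
rewrite -!big_split /= /simplex_norm -sumrN expR_sum -big_split /=.
apply: eq_bigr => i _.
have E (y y' : 'rV[R]_n) : ((y + y') *m invmx V) ord0 i = (y *m invmx V) ord0 i + (y' *m invmx V) ord0 i.
  by rewrite mulmxDl mxE.
have -> : x + w - x0 = (x - x0) + w by rewrite addrAC.
have -> : x + w + z - x0 = (x - x0) + w + z by rewrite addrAC (addrAC x).
have wi : (w *m invmx V) ord0 i = Num.max 0 (- (z *m invmx V) ord0 i).
  by rewrite /w mulmxK// mxE.
by rewrite !E wi pos_expD.
Qed.

End simplex_function.
End Simplex.

(** * Borel regularization of log-concave functions *)

Section LogConcave.
Context {R : realType}.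

(** The multiplicative form, as fed to the Prékopa-Leindler inequality; it avoids logarithms of
    0. *)
Definition logc n (f : 'rV[R]_n -> R) :=
  (forall x, 0 <= f x) /\ forall x y t, 0 < t < 1 ->
    f x `^ (1 - t) * f y `^ t <= f ((1 - t) *: x + t *: y).

Lemma log_concave_logc n (f : 'rV[R]_n -> R) : log_concave f -> logc f.
Proof.
move=> [f0 fc]; split => // x y t /andP[t0 t1].
have t1' : 0 < 1 - t by rewrite subr_gt0.
have := f0 x; rewrite le_eqVlt => /predU1P[<-|fx]; first by rewrite powR0 ?mul0r// lt0r_neq0.
have := f0 y; rewrite le_eqVlt => /predU1P[<-|fy]; first by rewrite powR0 ?mulr0// lt0r_neq0.
have /fc : 0 <= t <= 1 by rewrite !ltW.
move=> /(_ x y); rewrite /lnE fx fy -!EFinM -EFinD; case: ifPn => [fz|_]; last first.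
  by rewrite leNgt ltNyr.
rewrite lee_fin => H.
by rewrite /powR (gt_eqF fx) (gt_eqF fy) -expRD -[leRHS]lnK ?posrE// ler_expR.
Qed.

Lemma logc_powR n (f : 'rV[R]_n -> R) q : 0 < q -> logc f -> logc (fun x => f x `^ q).
Proof.
move=> q0 [f0 fc]; split => [x|x y t t01]; first exact: powR_ge0.
rewrite powRAC [X in _ * X]powRAC -powRM ?powR_ge0//.
apply: ge0_ler_powR; rewrite ?nnegrE ?mulr_ge0 ?powR_ge0 ?(ltW q0)//.
exact: fc.
Qed.

Lemma logc_cons n (f : 'rV[R]_n.+1 -> R) x : logc f -> logc (fun y => f (cons_rV x y)).
Proof.
move=> [f0 fc]; split => // y y' t t01; apply: le_trans (fc _ _ _ t01) _.
rewrite le_eqVlt; apply/orP; left; apply/eqP; congr f.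
have S k (u v : 'rV[R]_k) i : (((1 - t) *: u + t *: v) ord0 i =
    (1 - t) * u ord0 i + t * v ord0 i) by rewrite !mxE.
apply/rowP => i; rewrite S; have [j ->|->] := unliftP ord0 i.
  by rewrite !cons_rVS S.
by rewrite !cons_rV0; ring.
Qed.

Definition box n (p : 'rV[R]_n) (r : R) : set 'rV[R]_n :=
  [set w | forall i, `|w ord0 i - p ord0 i| < r].

Lemma box_center n (p : 'rV[R]_n) r : 0 < r -> box p r p.
Proof. by move=> r0 i; rewrite subrr normr0. Qed.

Lemma box_trans n (p q w : 'rV[R]_n) r s : box p r q -> box q s w -> box p (r + s) w.
Proof.
move=> pq qw i; rewrite (_ : _ - _ = (q ord0 i - p ord0 i) + (w ord0 i - q ord0 i)); last by ring.
by apply: le_lt_trans (ler_normD _ _) _; rewrite ltrD.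
Qed.

Lemma subset_box n (p w : 'rV[R]_n) r s : r <= s -> box p r w -> box p s w.
Proof. by move=> rs pw i; apply: lt_le_trans rs. Qed.

(** Two different slices have positive integral, hence each contains a box where [f] is bounded
    below; a box around the midpoint lies in the convex hull of the two, where log-concavity keeps
    the smaller bound. *)
Lemma logc_box n (f : 'rV[R]_n -> R) : logc f -> (0 < intRn (fun x => (f x)%:E))%E ->
  exists p r m, [/\ 0 < r, 0 < m & forall w, box p r w -> m <= f w].
Proof.
elim: n f => [|n IH] f lf If.
  have {}If : (0 < (f 0)%:E)%E := If.
  exists 0, 1, (f 0); split => //.
  by move=> w _; rewrite (thinmx0 w).
have f0 := lf.1; have fc := lf.2.
pose g x := intRn (fun y => (f (cons_rV x y))%:E).
have g0 x : (0 <= g x)%E by apply: intRn_ge0 => y; rewrite lee_fin.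
have [x1 gx1] : exists x, (0 < g x)%E.
  apply: contrapT => nx; move: If; rewrite intRnS integral0_eq ?ltxx// => x _.
  by apply/eqP; rewrite eq_le g0 andbT leNgt; apply/negP => gx; apply: nx; exists x.
(* A single slice with positive integral would contribute nothing to the outer integral. *)
have [x2 x21 gx2] : exists2 x, x != x1 & (0 < g x)%E.
  apply: contrapT => nx; move: If; rewrite intRnS (@integral_supp1 _ _ x1) ?ltxx// => x xx1.
  by apply/eqP; rewrite eq_le g0 andbT leNgt; apply/negP => gx; apply: nx; exists x.
have [p1 [r1 [m1 [r10 m10 fm1]]]] := IH _ (logc_cons x1 lf) gx1.
have [p2 [r2 [m2 [r20 m20 fm2]]]] := IH _ (logc_cons x2 lf) gx2.
pose m := Num.min m1 m2; have m0 : 0 < m by rewrite lt_min m10.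
pose r := Num.min r1 r2; have r0 : 0 < r by rewrite lt_min r10.
pose de := `|x2 - x1|; have de0 : 0 < de by rewrite normr_gt0 subr_eq0.
pose B := \sum_i `|p2 ord0 i - p1 ord0 i|.
have B0 : 0 <= B by apply: sumr_ge0.
have BE i : `|p2 ord0 i - p1 ord0 i| <= B.
  by rewrite /B (bigD1 i)//= lerDl; apply: sumr_ge0.
(* The first bound keeps the parameter [t] inside ]0, 1[; the second keeps the displacement [h], at
   most rho + (rho / de) B in each coordinate, within [r]. *)
pose rho := Num.min (de / 2) (r / (1 + B / de)).
have Bd : 0 < 1 + B / de by rewrite ltr_pwDl// divr_ge0// ltW.
have rho0 : 0 < rho by rewrite lt_min !divr_gt0.
exists (cons_rV ((x1 + x2) / 2) (2^-1 *: (p1 + p2))), rho, m; split => // w wb.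
have [u [v wE]] : exists u v, w = cons_rV u v.
  exists (w ord0 ord0), (\row_i w ord0 (lift ord0 i)).
  apply/rowP => i; have [j ->|->] := unliftP ord0 i.
    by rewrite cons_rVS mxE.
  by rewrite cons_rV0.
rewrite {}wE in wb *.
have ub := wb ord0; rewrite !cons_rV0 in ub.
have vb i : `|v ord0 i - (p1 ord0 i + p2 ord0 i) / 2| < rho.
  by have := wb (lift ord0 i); rewrite !cons_rVS !mxE mulrC.
pose t := (u - x1) / (x2 - x1).
have x210 : x2 - x1 != 0 by rewrite subr_eq0.
have tE : `|t - 2^-1| < rho / de.
  rewrite (_ : t - 2^-1 = (u - (x1 + x2) / 2) / (x2 - x1)); last by rewrite /t; field.
  by rewrite normrM normfV ltr_pM2r// invr_gt0.
have t01 : 0 < t < 1.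
  have : `|t - 2^-1| < 2^-1.
    apply: lt_le_trans tE _; rewrite ler_pdivrMr// mulrC.
    by rewrite ge_min lexx.
  by rewrite ltr_norml; lra.
pose h : 'rV[R]_n := v - (1 - t) *: p1 - t *: p2.
have hb i : `|h ord0 i| < r.
  have -> : h ord0 i = (v ord0 i - (p1 ord0 i + p2 ord0 i) / 2) +
      (2^-1 - t) * (p2 ord0 i - p1 ord0 i) by rewrite !mxE; field.
  apply: le_lt_trans (ler_normD _ _) _.
  apply: (@lt_le_trans _ _ (rho + rho / de * B)).
    apply: ltr_leD; first exact: vb.
    rewrite normrM; apply: ler_pM => //.
    by rewrite distrC ltW.
  have -> : rho + rho / de * B = rho * (1 + B / de) by field; exact: lt0r_neq0.
  by rewrite -ler_pdivlMr// ge_min lexx orbT.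
have -> : cons_rV u v = (1 - t) *: cons_rV x1 (p1 + h) + t *: cons_rV x2 (p2 + h).
  have S k (a b : 'rV[R]_k) i : (((1 - t) *: a + t *: b) ord0 i =
    (1 - t) * a ord0 i + t * b ord0 i) by rewrite !mxE.
  apply/rowP => i; rewrite S; have [j ->|->] := unliftP ord0 i.
    by rewrite !cons_rVS !mxE; ring.
  by rewrite !cons_rV0 /t; field.
apply: le_trans (fc _ _ _ t01).
have /andP[tp t1] := t01.
have pb p : box p r (p + h) by move=> i; rewrite mxE addrAC subrr add0r.
have mm : m = m `^ (1 - t) * m `^ t.
  by rewrite -powRD ?subrK ?powRr1 ?(ltW m0)// (gt_eqF m0) implybT.
rewrite {1}mm; apply: ler_pM; rewrite ?powR_ge0//; apply: ge0_ler_powR;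
  rewrite ?nnegrE ?subr_ge0 ?(ltW m0) ?(ltW t1) ?(ltW tp)//.
- apply: (@le_trans _ _ m1); first by rewrite ge_min lexx.
  by apply: fm1; apply: subset_box (pb p1); rewrite ge_min lexx.
- apply: (@le_trans _ _ m2); first by rewrite ge_min lexx orbT.
  by apply: fm2; apply: subset_box (pb p2); rewrite ge_min lexx orbT.
Qed.

End LogConcave.

Section LowerEnvelope.
Context {R : realType}.
Local Notation mu := (@lebesgue_measure R).

Lemma measurable_box d (T : measurableType d) n (p : 'rV[R]_n) r (u : T -> 'rV[R]_n) :
  coord_measurable u -> measurable [set t | box p r (u t)].
Proof.
move=> mu_; rewrite (_ : [set t | _] =
    \bigcap_(i in [set: 'I_n]) [set t | `|u t ord0 i - p ord0 i| < r]); last first.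
  by apply/seteqP; split => t /= H; [move=> i _; exact: H|move=> i; exact: H].
apply: fin_bigcap_measurable => // i _.
have m : measurable_fun setT (fun t => `|u t ord0 i - p ord0 i|).
  by apply: measurableT_comp => //; exact: measurable_funB.
rewrite -[X in measurable X]setTI.
exact: (measurable_fun_ltr m (measurable_cst r)).
Qed.

Lemma Bor_indic_box n (p : 'rV[R]_n) r : Bor (fun x => (\1_(box p r) x)%:E).
Proof.
move=> d T u mu_; apply/measurable_EFinP.
rewrite (_ : (fun t => _) = (\1_[set t | box p r (u t)] : T -> R)); last first.
  by apply/funext => t; rewrite !indicE; congr (_%:R); apply/idP/idP; rewrite !inE.
by apply: measurable_indic; exact: measurable_box.
Qed.

Lemma intRn_box n (p : 'rV[R]_n) r : 0 < r ->
  intRn (fun x => (\1_(box p r) x)%:E) = ((r *+ 2) ^+ n)%:E.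
Proof.
move=> r0; elim: n p => [|n IH] p.
  by rewrite /intRn indicE mem_set// => -[].
rewrite intRnS; pose p' := \row_i p ord0 (lift ord0 i).
have boxE x y : box p r (cons_rV x y) <-> ball (p ord0 ord0) r x /\ box p' r y.
  split=> [H|[xb yb] i].
    split=> [|i]; first by have := H ord0; rewrite cons_rV0 /ball /= distrC.
    by have := H (lift ord0 i); rewrite cons_rVS mxE.
  have [j ->|->] := unliftP ord0 i; last by rewrite cons_rV0 distrC.
  by have := yb j; rewrite cons_rVS mxE.
transitivity (\int[mu]_x (((r *+ 2) ^+ n)%:E * (\1_(ball (p ord0 ord0) r) x)%:E))%E.
  apply: eq_integral => x _; rewrite -(IH p') muleC -intRnZl; last 3 first.
  - exact: Bor_indic_box.
  - by move=> y; rewrite lee_fin.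
  - by rewrite lee_fin.
  apply: eq_intRn => y; rewrite -EFinM !indicE -natrM mulnb.
  congr ((nat_of_bool _)%:R%:E); apply/idP/andP; rewrite !inE => /boxE //.
have mball : measurable_fun setT (EFin \o (\1_(ball (p ord0 ord0) r) : R -> R)).
  by apply/measurable_EFinP; apply: measurable_indic; exact: measurable_ball.
rewrite (ge0_integralZl mu measurableT mball); last 2 first.
- by move=> x _; rewrite lee_fin.
- by rewrite lee_fin exprn_ge0// mulrn_wge0// ltW.
rewrite integral_indic//; last exact: measurable_ball.
rewrite setIT exprSr EFinM; congr (_ * _)%E.
exact: lebesgue_measure_ball (ltW r0).
Qed.

(** On the box of half size midway between [y] and [p] every x is the midpoint of y and a point w of
    the given box, so f(x)^2 >= f(y) f(w) >= m f(y), and the integral of f^2 bounds f(y). *)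
Lemma logc_bounded n (f : 'rV[R]_n -> R) p r m : logc f -> 0 < r -> 0 < m ->
  (forall w, box p r w -> m <= f w) ->
  (intRn (fun x => (f x ^+ 2)%:E) < +oo)%E -> exists2 M, 0 < M & forall x, f x <= M.
Proof.
move=> [f0 fc] r0 m0 fm foo.
set I := intRn _ in foo.
have r20 : 0 < r / 2 by rewrite divr_gt0.
pose c := ((r / 2) *+ 2) ^+ n; have c0 : 0 < c by rewrite exprn_gt0// mulrn_wgt0.
have key y : ((f y * m * c)%:E <= I)%E.
  apply: (@le_trans _ _ (intRn (fun x => (f y * m)%:E * (\1_(box (2^-1 *: (y + p)) (r / 2)) x)%:E)%E)).
    rewrite intRnZl.
    - by rewrite intRn_box.
    - exact: Bor_indic_box.
    - by move=> x; rewrite lee_fin.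
    - by rewrite lee_fin mulr_ge0// ltW.
  apply: le_intRn => x; first by rewrite mule_ge0// lee_fin mulr_ge0// ltW.
  rewrite indicE; case: (boolP (x \in _)) => [|_]; last by rewrite mule0 lee_fin sqr_ge0.
  rewrite inE => xb; rewrite mule1 lee_fin.
  pose w := 2 *: x - y.
  have wb : box p r w.
    move=> i; have := xb i; rewrite !mxE => H.
    rewrite (_ : _ - _ = 2 * (x ord0 i - 2^-1 * (y ord0 i + p ord0 i))); last by field.
    by rewrite normrM ger0_norm// mulrC -ltr_pdivlMr.
  have h01 : 0 < (2^-1 : R) < 1 by rewrite invr_gt0 ltr0n invf_lt1 ?ltr1n.
  have := fc y w _ h01; rewrite (_ : (1 - 2^-1) *: y + 2^-1 *: w = x); last first.
    by apply/rowP => i; rewrite !mxE; field.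
  rewrite (_ : 1 - 2^-1 = 2^-1 :> R); last by field.
  rewrite -powRM// => H; apply: (@le_trans _ _ (f y * f w)).
    by apply: ler_wpM2l => //; exact: fm.
  have yw0 : 0 <= f y * f w by rewrite mulr_ge0.
  rewrite -[leLHS](powRr1 yw0) -(mulVf (_ : 2 != 0 :> R))// powRrM powR_mulrn ?powR_ge0//.
  by apply: lerXn2r => //; rewrite nnegrE ?powR_ge0.
have I0 : (0 <= I)%E by apply: intRn_ge0 => x; rewrite lee_fin sqr_ge0.
have [J JE] : exists J, I = J%:E.
  by move: I0 foo; case: I key => // J _ _ _; exists J.
exists (J / (m * c) + 1); last first.
  move=> y; have := key y; rewrite JE lee_fin -mulrA -ler_pdivlMr ?mulr_gt0// => H.
  by apply: le_trans H _; rewrite lerDl.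
rewrite ltr_wpDl// divr_ge0//; last by rewrite ltW// mulr_gt0.
by rewrite -lee_fin -JE.
Qed.

Section env.
Context (n : nat) (f : 'rV[R]_n -> R) (lf : logc f).
Let f0 := lf.1.
Let fc := lf.2.

Definition env_set (z : 'rV[R]_n) : set R :=
  [set c | 0 <= c /\ exists k : nat, forall w, box z k.+1%:R^-1 w -> c <= f w].

(* The lower semicontinuous envelope of [f]. *)
Definition env (z : 'rV[R]_n) : R := sup (env_set z).

Let kpos (k : nat) : (0 : R) < k.+1%:R^-1. Proof. by rewrite invr_gt0. Qed.

Lemma env_set_ub z : ubound (env_set z) (f z).
Proof. by move=> c [_ [k H]]; apply: H; exact: box_center. Qed.

Lemma env_has_sup z : has_sup (env_set z).
Proof.
by split; [exists 0; split => //; exists 0%N|exists (f z); exact: env_set_ub].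
Qed.

Lemma env_le z : env z <= f z.
Proof. by apply: ge_sup; [case: (env_has_sup z)|exact: env_set_ub]. Qed.

Lemma exists_inv (r : R) : 0 < r -> exists k : nat, k.+1%:R^-1 <= r.
Proof.
move=> r0; exists (Num.truncn r^-1).
by rewrite -[leRHS]invrK lef_pV2 ?posrE ?invr_gt0// ltW// truncnS_gt.
Qed.

Lemma env_ge z r c : 0 < r -> 0 <= c -> (forall w, box z r w -> c <= f w) -> c <= env z.
Proof.
move=> r0 c0 H; have [k kr] := exists_inv r0.
apply: ub_le_sup; first by case: (env_has_sup z).
by split => //; exists k => w wb; apply: H; exact: subset_box wb.
Qed.

Lemma env_ge0 z : 0 <= env z.
Proof. by apply: (@env_ge _ 1). Qed.

Lemma env_adherent z c : c < env z -> exists2 c', c < c' & env_set z c'.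
Proof.
move=> cz; have [c' Ec'] := @sup_adherent _ (env_set z) (env z - c) (ltac:(by rewrite subr_gt0)) (env_has_sup z).
by rewrite subKr => cc'; exists c'.
Qed.

(** A displacement of the combined point is realized by the same displacement of both [x] and
    [y]. *)
Lemma env_combine (x y : 'rV[R]_n) (t r cx cy : R) : 0 < t < 1 -> 0 < r ->
  0 <= cx -> 0 <= cy ->
  (forall w, box x r w -> cx <= f w) -> (forall w, box y r w -> cy <= f w) ->
  cx `^ (1 - t) * cy `^ t <= env ((1 - t) *: x + t *: y).
Proof.
move=> t01 r0 cx0 cy0 fx fy; have /andP[t0 t1] := t01.
apply: (env_ge r0); first by rewrite mulr_ge0 ?powR_ge0.
move=> w wb; pose h := w - ((1 - t) *: x + t *: y).
have hb z : box z r (z + h).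
  by move=> i; have := wb i; rewrite !mxE; congr (`|_| < _); ring.
have -> : w = (1 - t) *: (x + h) + t *: (y + h).
  by apply/rowP => i; rewrite !mxE; ring.
apply: le_trans (fc _ _ t01); apply: ler_pM; rewrite ?powR_ge0//;
apply: ge0_ler_powR; rewrite ?nnegrE ?subr_ge0 ?(ltW t0) ?(ltW t1)//.
- by apply: fx.
- by apply: fy.
Qed.

Lemma logc_env : logc env.
Proof.
split; first exact: env_ge0.
move=> x y t t01; have /andP[t0 t1] := t01.
have t1' : 0 < 1 - t by rewrite subr_gt0.
have := env_ge0 x; rewrite le_eqVlt => /predU1P[<-|ex].
  by rewrite powR0 ?lt0r_neq0// mul0r env_ge0.
have := env_ge0 y; rewrite le_eqVlt => /predU1P[<-|ey].
  by rewrite powR0 ?lt0r_neq0// mulr0 env_ge0.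
set v := env x `^ (1 - t) * env y `^ t.
have v0 : 0 < v by rewrite mulr_gt0 ?powR_gt0.
rewrite leNgt; apply/negP => lt_v; set e := env _ in lt_v.
have e0 : 0 <= e by exact: env_ge0.
(* Chosen so that ka v is the midpoint of e and v: replacing both envelopes by nearly attained
   bounds above [ka] times their values still beats [e]. *)
pose ka := (e + v) / (2 * v).
have ka0 : 0 < ka by apply: divr_gt0; lra.
have ka1 : ka < 1 by rewrite ltr_pdivrMr; lra.
have [cx cx1 [cx0 [k1 H1]]] : exists2 c', ka * env x < c' & env_set x c'.
  by apply: env_adherent; rewrite gtr_pMl.
have [cy cy1 [cy0 [k2 H2]]] : exists2 c', ka * env y < c' & env_set y c'.
  by apply: env_adherent; rewrite gtr_pMl.
have := @env_combine x y t (Num.min k1.+1%:R^-1 k2.+1%:R^-1) cx cy t01.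
rewrite lt_min !kpos => /(_ isT cx0 cy0) H.
have : cx `^ (1 - t) * cy `^ t <= e.
  apply: H => w wb; [apply: H1|apply: H2]; apply: subset_box wb;
  by rewrite ge_min lexx ?orbT.
apply/negP; rewrite -ltNge.
apply: (@lt_le_trans _ _ ((ka * env x) `^ (1 - t) * (ka * env y) `^ t)).
  rewrite (powRM _ (ltW ka0) (ltW ex)) (powRM _ (ltW ka0) (ltW ey)) mulrACA -powRD ?subrK; last first.
    by rewrite (gt_eqF ka0) implybT.
  rewrite powRr1 ?(ltW ka0)// -/v /ka -(ltr_pM2r (_ : 0 < 2))// -mulrA.
  have -> : (e + v) / (2 * v) * (v * 2) = e + v by field; exact: lt0r_neq0.
  by lra.
have mono p a b : 0 < p -> 0 <= a -> a < b -> a `^ p <= b `^ p.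
  move=> p0 a0 ab; apply: (ge0_ler_powR (ltW p0)) => //; last exact: ltW.
  by rewrite nnegrE (le_trans a0)// ltW.
apply: ler_pM; rewrite ?powR_ge0//; apply: mono => //; apply: mulr_ge0; exact: ltW.
Qed.

(** Contracting the box around [p] towards [y] gives a box of radius t r around the new centre,
    every point of which is a combination of [y] and a point of the original box. *)
Lemma env_ray p r m (y : 'rV[R]_n) t : 0 < r -> 0 <= m -> 0 < t < 1 ->
  (forall w, box p r w -> m <= f w) ->
  f y `^ (1 - t) * m `^ t <= env ((1 - t) *: y + t *: p).
Proof.
move=> r0 m0 t01 fm; have /andP[t0 t1] := t01.
apply: (@env_ge _ (t * r)); [by rewrite mulr_gt0|by rewrite mulr_ge0 ?powR_ge0|].
move=> w wb; pose w' := t^-1 *: (w - (1 - t) *: y).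
have -> : w = (1 - t) *: y + t *: w'.
  by rewrite /w' scalerA mulfV ?lt0r_neq0// scale1r addrC subrK.
apply: le_trans (fc _ _ t01); apply: ler_wpM2l; first exact: powR_ge0.
apply: ge0_ler_powR; rewrite ?nnegrE ?(ltW t0)//; apply: fm => i.
have := wb i; rewrite !mxE => H.
rewrite (_ : _ - _ = t^-1 * (w ord0 i - ((1 - t) * y ord0 i + t * p ord0 i))); last first.
  by field; exact: lt0r_neq0.
by rewrite normrM gtr0_norm ?invr_gt0// mulrC ltr_pdivrMr// [r * t]mulrC.
Qed.

(** The superlevel set of a lower semicontinuous function is open, written here as a countable union
    of boxes with rational centres. *)
Lemma Bor_env : Bor (fun z => (env z)%:E).
Proof.
move=> d T u mu_; apply/measurable_EFinP.
move=> mT; apply: (measurability _ (RGenOInfty.measurableE R)) => //.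
move=> _ [_ [c ->] <-]; rewrite setTI.
pose Q (i : 'rV[rat]_n * nat) := exists2 c', c < c' & 0 <= c' /\
  forall w, box (map_mx ratr i.1) (2 / i.2.+1%:R) w -> c' <= f w.
pose B (i : 'rV[rat]_n * nat) : set T :=
  if `[< Q i >] then [set t | box (map_mx ratr i.1) i.2.+1%:R^-1 (u t)] else set0.
rewrite (_ : _ @^-1` _ = \bigcup_i B i); last first.
  apply/seteqP; split => t /=.
    rewrite in_itv /= andbT => /env_adherent[c' cc' [c'0 [k H]]].
    (* Makes 1 / (k' + 1) a third of 1 / (k + 1): one third to reach the rational centre and two
       thirds for the radius required by [Q]. *)
    pose k' := (3 * k + 2)%N.
    have k'E : k'.+1%:R = 3 * k.+1%:R :> R.
      by rewrite /k' -natrM; congr _%:R; rewrite mulnS addnC.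
    have [q qb] : exists q : 'rV[rat]_n, box (map_mx ratr q) k'.+1%:R^-1 (u t).
      have ex i : exists q : rat, `|u t ord0 i - ratr q| < k'.+1%:R^-1.
        have lt : u t ord0 i - k'.+1%:R^-1 < u t ord0 i + k'.+1%:R^-1.
          by rewrite ltrD2l gtrN.
        have [q] := rat_in_itvoo lt; move: (k'.+1%:R^-1) => e.
        rewrite in_itv /= => /andP[q1 q2]; exists q.
        by rewrite ltr_norml; apply/andP; split; lra.
      have [h hP] := choice ex.
      by exists (\row_i h i) => i; rewrite !mxE.
    exists (q, k') => //; rewrite /B asboolT//=; exists c' => //; split => // w wb; apply: H.
    have qb' : box (u t) k'.+1%:R^-1 (map_mx ratr q) by move=> i; rewrite distrC.
    apply: subset_box (box_trans qb' wb).
    rewrite k'E; have k0 : (k.+1%:R : R) != 0 by rewrite pnatr_eq0.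
    by rewrite le_eqVlt; apply/orP; left; apply/eqP; field; rewrite ?k0.
  move=> [[q k] _]; rewrite /B; case: asboolP => // -[c' cc' [c'0 H]] /= tb.
  rewrite in_itv /= andbT; apply: lt_le_trans cc' _.
  apply: (env_ge (kpos k) c'0) => w wb; apply: H.
  by apply: subset_box (box_trans tb wb); rewrite (_ : _ + _ = 2 / k.+1%:R)//; ring.
apply: countable_bigcupT_measurable; first exact: countableP.
by move=> i; rewrite /B; case: asboolP => // _; exact: measurable_box.
Qed.

End env.
End LowerEnvelope.

Section Regularization.
Context {R : realType}.

(** The limit s -> 0 is made explicit: s D = ln (1 + e / (J + 1)) costs at most e, and J + 1 avoids
    a division by zero. *)
Lemma le_expR_mul (I J : \bar R) (D : R) : 0 < D -> (0 <= J)%E ->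
  (forall s : R, 0 < s -> (I <= (expR (s * D))%:E * J)%E) -> (I <= J)%E.
Proof.
move=> D0; case: J => [J J0 H|_ _|]; [|exact: leey|by rewrite leNgt ltNyr].
rewrite lee_fin in J0; apply/lee_addgt0Pr => e e0.
have J1 : 0 < J + 1 by rewrite ltr_wpDl.
have e1 : 0 < e / (J + 1) by rewrite divr_gt0.
have s0 : 0 < ln (1 + e / (J + 1)) / D by rewrite divr_gt0// ln_gt0// ltrDl.
apply: le_trans (H _ s0) _; have e2 : 0 < 1 + e / (J + 1) by rewrite addr_gt0.
rewrite (divfK (lt0r_neq0 D0)) lnK//.
rewrite -EFinM -EFinD lee_fin mulrDl mul1r lerD2l -mulrA ger_pMr//.
by rewrite mulrC ler_pdivrMr// mul1r lerDl.
Qed.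

(* [f] may fail to be measurable on the boundary of its support; contracting
   towards the centre [p] of a box where [m <= f] gives
   [env f ((1 - t) y + t p) >= (m / M)^t f y], and integrating and letting [t]
   tend to [0] shows that [env f] has the same integrals. *)
Lemma regularization n (f : 'rV[R]_n -> R) : logc f ->
  (intRn (fun x => (f x ^+ 2)%:E) < +oo)%E ->
  exists g : 'rV[R]_n -> R, [/\ logc g, Bor (fun x => (g x)%:E), forall x, g x <= f x,
    forall q, 0 < q -> intRn (fun x => (f x `^ q)%:E) = intRn (fun x => (g x `^ q)%:E) &
    (forall x, g x = 0) \/
    exists p r m, [/\ 0 < r, 0 < m & forall w, box p r w -> m <= g w]].
Proof.
move=> lf foo; have f0 := lf.1.
have [[p [r [m [r0 m0 fm]]]]|nobox] := pselect (exists p r m,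
    [/\ 0 < r, 0 < m & forall w, box p r w -> m <= f w]); last first.
  exists (fun=> 0); split.
  - by split => // x y t /andP[t0 _]; rewrite [X in _ * X]powR0 ?mulr0// lt0r_neq0.
  - by move=> d T u mu_; exact: measurable_cst.
  - by move=> x; exact: f0.
  - move=> q q0; have -> : intRn (fun x : 'rV[R]_n => (0 `^ q)%:E) = 0%E :> \bar R.
      under eq_intRn do rewrite powR0 ?lt0r_neq0//.
      elim: (n) => [//|k IH]; rewrite intRnS; apply: integral0_eq => x _; exact: IH.
    apply/eqP; rewrite eq_le intRn_ge0 ?andbT; last by move=> x; rewrite lee_fin powR_ge0.
    (* A positive integral of [f] to the power [q], itself log-concave, would produce a box. *)
    rewrite leNgt; apply/negP => /(logc_box (logc_powR q0 lf)) [p [r [m [r0 m0 fm]]]].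
    apply: nobox; exists p, r, (m `^ q^-1); split => // [|w /fm H]; first by rewrite powR_gt0.
    rewrite -[leRHS](powRr1 (f0 w)) -(mulfV (lt0r_neq0 q0)) powRrM.
    by apply: ge0_ler_powR; rewrite ?nnegrE ?invr_ge0 ?powR_ge0 ?(ltW q0) ?(ltW m0).
  - by left.
have [M M0 fM] := logc_bounded lf r0 m0 fm foo.
exists (env f); split.
- exact: logc_env.
- exact: Bor_env.
- by move=> x; exact: env_le.
- move=> q q0; apply/eqP; rewrite eq_le; apply/andP; split; last first.
    apply: le_intRn => x; first by rewrite lee_fin powR_ge0.
    rewrite lee_fin; apply: ge0_ler_powR; rewrite ?nnegrE ?(ltW q0) ?env_ge0//.
    exact: env_le.
  set J := intRn (fun x => (env f x `^ q)%:E).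
  have B : Bor (fun x => (env f x `^ q)%:E).
    move=> d T u mu_; apply/measurable_EFinP.
    apply: (measurableT_comp (measurable_powR q)).
    by have := Bor_env lf mu_ => /measurable_EFinP.
  have B0 x : (0 <= (env f x `^ q)%:E)%E by rewrite lee_fin powR_ge0.
  have J0 : (0 <= J)%E by exact: intRn_ge0.
  pose C := M / m.
  have C1 : 1 <= C.
    by rewrite ler_pdivlMr// mul1r (le_trans (fm p (box_center p r0))).
  have lnC : 0 <= ln C by exact: ln_ge0.
  (* The factor C^(t q) (1 - t)^(-n) is at most exp (s (q ln C + n)); the extra 1 makes [D]
     positive. *)
  pose D := q * ln C + n%:R + 1.
  have D0 : 0 < D by rewrite ltr_wpDl// addr_ge0// mulr_ge0// ltW.
  apply: (le_expR_mul D0 J0) => s s0.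
  (* With this choice the Jacobian (1 - t)^(-n) is exactly exp (n s), and t <= s. *)
  pose t := 1 - expR (- s).
  have t01 : 0 < t < 1.
    by rewrite subr_gt0 -expR0 ltr_expR oppr_lt0 s0/= expR0 gtrBl expR_gt0.
  have /andP[t0 t1] := t01.
  have ts : t <= s by have := expR_ge1Dx (- s); rewrite /t; lra.
  have K0 : 0 <= C `^ (t * q) by exact: powR_ge0.
  have u0 : 0 < 1 - t by rewrite subr_gt0.
  apply: (@le_trans _ _ ((C `^ (t * q))%:E * ((1 - t) ^- n)%:E * J)%E); last first.
    apply: lee_wpmul2r => //; rewrite -EFinM lee_fin.
    have -> : (1 - t) ^- n = expR (n%:R * s).
      by rewrite /t subKr -expRM_natl mulrN expRN invrK.
    rewrite /powR gt_eqF; last exact: lt_le_trans C1.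
    rewrite -expRD ler_expR /D; have : t * q * ln C <= s * q * ln C.
      by rewrite !ler_wpM2r// ltW.
    lra.
  have -> : ((C `^ (t * q))%:E * ((1 - t) ^- n)%:E * J =
      intRn (fun y => (C `^ (t * q))%:E * (env f ((1 - t) *: y + t *: p) `^ q)%:E))%E.
    rewrite intRnZl.
    - by rewrite (intRn_affine (f := fun x => (env f x `^ q)%:E))// muleA.
    - move=> d T u mu_; apply: (B _ _ (fun x => (1 - t) *: u x + t *: p)).
      apply: coord_measurableD; last exact: coord_measurable_cst.
      by apply: coord_measurableZ => //; exact: measurable_cst.
    - by move=> x; exact: B0.
    - by rewrite lee_fin.
  apply: le_intRn => y; first by rewrite lee_fin powR_ge0.
  rewrite -EFinM lee_fin powRrM -powRM ?powR_ge0 ?env_ge0//.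
  apply: ge0_ler_powR; rewrite ?nnegrE ?(ltW q0) ?mulr_ge0 ?powR_ge0 ?env_ge0//.
  apply: (@le_trans _ _ (C `^ t * (f y `^ (1 - t) * m `^ t))); last first.
    by apply: ler_wpM2l; [exact: powR_ge0|exact: (env_ray lf _ r0 (ltW m0) t01 fm)].
  rewrite mulrCA -powRM ?(ltW m0)//; last by apply: le_trans C1.
  rewrite divfK ?lt0r_neq0//.
  apply: (@le_trans _ _ (f y `^ (1 - t) * f y `^ t)).
    rewrite -powRD ?subrK ?powRr1//.
    by rewrite (gt_eqF (ltr01 : 0 < 1 :> R)).
  apply: ler_wpM2l; first exact: powR_ge0.
  by apply: ge0_ler_powR; rewrite ?nnegrE ?(ltW t0) ?(ltW M0).
- right; exists p, (r / 2), m; split => //; first by rewrite divr_gt0.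
  move=> z zb; have r20 : 0 < r / 2 by rewrite divr_gt0.
  apply: (env_ge lf r20 (ltW m0)).
  move=> w wb; apply: fm; apply: subset_box (box_trans zb wb).
  by rewrite -splitr.
Qed.

End Regularization.

(** * Interpolation of Lebesgue norms *)

Section Interpolation.
Context {R : realType}.

(** Hölder's inequality through its pointwise proof: with t = p - 1, g^p = K (g / A)^(1 - t) (g^2 /
    B)^t is at most K times a weighted mean of g / A and g^2 / B, each of integral 1. *)
Lemma intRn_interpolation n (g : 'rV[R]_n -> R) (A B p : R) :
  Bor (fun x => (g x)%:E) -> (forall x, 0 <= g x) -> 0 < A -> 0 < B -> 1 < p < 2 ->
  intRn (fun x => (g x)%:E) = A%:E -> intRn (fun x => (g x ^+ 2)%:E) = B%:E ->
  (intRn (fun x => (g x `^ p)%:E) <= (A `^ (2 - p) * B `^ (p - 1))%:E)%E.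
Proof.
move=> Bg g0 A0 B0 /andP[p1 p2] gA gB.
have t01 : 0 < p - 1 < 1 by rewrite subr_gt0 p1/=; lra.
have /andP[t0 t1] := t01.
set t := p - 1 in t0 t1 t01 *; set K := A `^ (2 - p) * B `^ t.
have K0 : 0 <= K by rewrite mulr_ge0 ?powR_ge0.
have a0 : 0 <= (1 - t) / A by rewrite divr_ge0 ?subr_ge0 ?ltW.
have b0 : 0 <= t / B by rewrite divr_ge0 ?ltW.
have B2 := Bor_sqr Bg.
have g0e x : (0 <= (g x)%:E)%E by rewrite lee_fin.
have g2e x : (0 <= (g x ^+ 2)%:E)%E by rewrite lee_fin sqr_ge0.
have BA : Bor (fun x => (((1 - t) / A)%:E * (g x)%:E)%E).
  by move=> d T u mu_; apply: measurable_funeM; exact: Bg.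
have BB : Bor (fun x => ((t / B)%:E * (g x ^+ 2)%:E)%E).
  by move=> d T u mu_; apply: measurable_funeM; exact: B2.
have h1 x : (0 <= ((1 - t) / A)%:E * (g x)%:E)%E by rewrite mule_ge0.
have h2 x : (0 <= (t / B)%:E * (g x ^+ 2)%:E)%E by rewrite mule_ge0.
apply: (@le_trans _ _ (intRn (fun x => K%:E *
    (((1 - t) / A)%:E * (g x)%:E + (t / B)%:E * (g x ^+ 2)%:E))%E)).
  apply: le_intRn => x; first by rewrite lee_fin powR_ge0.
  rewrite -!EFinM lee_fin.
  have gA0 : 0 <= g x / A by rewrite divr_ge0// ltW.
  have gB0 : 0 <= g x ^+ 2 / B by rewrite divr_ge0 ?sqr_ge0// ltW.
  have := powR_amgm t01 gA0 gB0 => H.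
  have -> : g x `^ p = K * ((g x / A) `^ (1 - t) * (g x ^+ 2 / B) `^ t).
    rewrite /K (_ : 2 - p = 1 - t); last by rewrite /t; ring.
    rewrite mulrACA -!powRM ?(ltW A0) ?(ltW B0)//.
    rewrite !(mulrC A, mulrC B) !divfK ?lt0r_neq0//.
    rewrite -powR_mulrn// -powRrM -powRD.
      by congr powR; rewrite /t; ring.
    by apply/implyP => /eqP; rewrite /t; lra.
  apply: ler_wpM2l => //; apply: le_trans H _.
  by rewrite le_eqVlt; apply/orP; left; apply/eqP; ring.
rewrite intRnZl; [|by move=> d T u mu_; apply: emeasurable_funD; [exact: BA|exact: BB]
  |by move=> x; rewrite adde_ge0|by rewrite lee_fin].
rewrite intRnD// !intRnZl// gA gB -!EFinM lee_fin.
by rewrite !divfK ?lt0r_neq0// subrK mulr1.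
Qed.

Lemma intRn_gt0_box n (g : 'rV[R]_n -> R) p r m : (forall x, 0 <= g x) -> 0 < r -> 0 < m ->
  (forall w, box p r w -> m <= g w) -> (0 < intRn (fun x => (g x)%:E))%E.
Proof.
move=> g0 r0 m0 gm.
apply: (@lt_le_trans _ _ (intRn (fun x => m%:E * (\1_(box p r) x)%:E)%E)).
  rewrite intRnZl; [|exact: Bor_indic_box|by move=> x; rewrite lee_fin|by rewrite lee_fin ltW].
  by rewrite intRn_box// -EFinM lte_fin mulr_gt0// exprn_gt0// mulrn_wgt0.
apply: le_intRn => x; first by rewrite mule_ge0// lee_fin ltW.
rewrite indicE; case: (boolP (x \in _)) => [|_]; last by rewrite mule0 lee_fin.
by rewrite inE => /gm ?; rewrite mule1 lee_fin.
Qed.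

Lemma rhs_H_le_mid m (al : R) (g : 'rV[R]_m.+1 -> R) :
  0 < al -> al < m.+1%:R -> Bor (fun x => (g x)%:E) -> (forall x, 0 <= g x) ->
  (corr g 0 < +oo)%E ->
  (forall x, g x = 0) \/
    (exists p r c, [/\ 0 < r, 0 < c & forall w, box p r w -> c <= g w]) ->
  (rhs_H al g <= mid_H al g)%E.
Proof.
move=> al0 al_lt Bg g0 goo gbox.
set b := al / m.+1%:R; have b0 : 0 < b by rewrite divr_gt0.
have b1 : b < 1 by rewrite ltr_pdivrMr// mul1r.
have N0 : (m.+1%:R : R) != 0 by rewrite pnatr_eq0.
set p := 2 * m.+1%:R / (m.+1%:R + al).
have pE : p = 2 / (1 + b).
  have N1 : m.+1%:R + al != 0 by rewrite lt0r_neq0// addr_gt0.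
  by rewrite /p /b; move: (m.+1%:R : R) N0 N1 => N N0 N1; field; rewrite N0.
have b10 : 0 < 1 + b by rewrite addr_gt0.
have p12 : 1 < p < 2.
  by rewrite pE ltr_pdivlMr// ltr_pdivrMr//; lra.
have p0 : 0 < p by case/andP: p12 => + _; exact: lt_trans.
have rhsE : rhs_H al g = poweR (intRn (fun x => (g x `^ p)%:E)) (1 + b).
  rewrite /rhs_H /Lpn -/p -poweRrM.
  have -> : p^-1 * 2 = 1 + b by rewrite pE; field; exact: lt0r_neq0.
  by congr poweR; apply: eq_intRn => x; rewrite ger0_norm.
rewrite mid_HE// -/b.
(* The box makes both integrals positive, as required for dividing by them in the interpolation. *)
have [gz|[c [r [k [r0 k0 gk]]]]] := gbox.
  rewrite rhsE [X in poweR X _](_ : _ = 0%E) ?poweR0r ?lt0r_neq0//.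
    by rewrite mule_ge0// poweR_ge0.
  rewrite -[RHS](mul0e (intRn (fun x => (g x)%:E))) -intRnZl//.
  by apply: eq_intRn => x; rewrite gz mul0e powR0// lt0r_neq0.
have A0 := intRn_gt0_box g0 r0 k0 gk.
have B0 : (0 < corr g 0)%E.
  rewrite corr0; apply: (@intRn_gt0_box _ (fun x => g x ^+ 2) c r (k ^+ 2)) => //.
  - by move=> x; rewrite sqr_ge0.
  - by rewrite exprn_gt0.
  - by move=> w /gk ?; rewrite lerXn2r ?nnegrE ?(ltW k0).
have [B BE] : exists B, corr g 0 = B%:E.
  by move: B0 goo; case: (corr g 0) => // B _ _; exists B.
have {}B0 : 0 < B by rewrite -lte_fin -BE.
rewrite intRn_corr//.
have [Ay|Ay] := eqVneq (intRn (fun x => (g x)%:E)) +oo%E.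
  rewrite Ay mulyy BE poweRyr ?lt0r_neq0// poweR_EFin gt0_muley ?leey//.
  by rewrite lte_fin powR_gt0.
have [A AE] : exists A, intRn (fun x => (g x)%:E) = A%:E.
  by move: A0 Ay; case: (intRn _) => // A _ _; exists A.
have {}A0 : 0 < A by rewrite -lte_fin -AE.
have H := intRn_interpolation Bg g0 A0 B0 p12 AE (etrans (esym (corr0 g)) BE).
have I0 : (0 <= intRn (fun x => (g x `^ p)%:E))%E.
  by apply: intRn_ge0 => x; rewrite lee_fin powR_ge0.
rewrite rhsE AE BE -!EFinM.
apply: (@le_trans _ _ (poweR (A `^ (2 - p) * B `^ (p - 1))%:E (1 + b))).
  apply: gt0_ler_poweR; rewrite ?(ltW b10) ?in_itv /= ?leey ?andbT//.
  by rewrite lee_fin mulr_ge0 ?powR_ge0.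
rewrite poweR_EFin lee_fin !powRM ?powR_ge0 ?(ltW A0)// -!powRrM -powRD ?(gt_eqF A0) ?implybT//.
rewrite mulrC le_eqVlt; apply/orP; left; apply/eqP.
(* As p = 2 / (1 + b), the exponents are (2 - p) (1 + b) = 2 b and (p - 1) (1 + b) = 1 - b. *)
by congr (_ `^ _ * _ `^ _); rewrite pE; field; exact: lt0r_neq0.
Qed.

End Interpolation.

(** * Passage from the regularization back to the original function *)

Lemma eq_Lpn (R : realType) n (f g : 'rV[R]_n -> R) (q : R) :
  (forall x, 0 <= f x) -> (forall x, 0 <= g x) ->
  intRn (fun x => (f x `^ q)%:E) = intRn (fun x => (g x `^ q)%:E) -> Lpn f q = Lpn g q.
Proof.
move=> f0 g0 fg; rewrite /Lpn.
under eq_intRn do rewrite ger0_norm//.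
by under [in RHS]eq_intRn do rewrite ger0_norm//; rewrite fg.
Qed.

Lemma le_indic (R : realType) T (A B : set T) (x : T) : A `<=` B ->
  ((\1_A x)%:E <= (\1_B x)%:E :> \bar R)%E.
Proof.
move=> AB; rewrite lee_fin !indicE ler_nat.
by case: (boolP (x \in A)) => //; rewrite inE => /AB Bx; rewrite mem_set.
Qed.

(** Correlations, ray moments and hence [Hset] grow with the function, by monotonicity of iterated
    integrals alone. *)
Lemma le_lhs_H (R : realType) m (al : R) (f g : 'rV[R]_m.+1 -> R) : 0 < al ->
  (forall x, 0 <= g x) -> (forall x, g x <= f x) -> (lhs_H al g <= lhs_H al f)%E.
Proof.
move=> al0 g0 gf; apply: lee_wpmul2l.
  by rewrite lee_fin divr_ge0 ?powR_ge0// ltW// Gamma_gt0.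
have v0 h : (0 <= volH al h)%E by apply: intRn_ge0 => x; rewrite lee_fin.
have b0 : 0 <= al / m.+1%:R by rewrite divr_ge0// ltW.
apply: (gt0_ler_poweR b0); [by rewrite in_itv /= leey andbT; exact: v0|
  by rewrite in_itv /= leey andbT; exact: v0|].
have Hgf : Hset al g `<=` Hset al f; last first.
  by apply: le_intRn => x; [rewrite lee_fin|exact: le_indic].
move=> x [->|H]; first by left.
right; apply: le_trans H _.
apply: (@le_Mellin _ al (fun t => corr g (t *: ((enorm x)^-1 *: x)))
   (fun t => corr f (t *: ((enorm x)^-1 *: x)))) => t.
  by apply: intRn_ge0 => y; rewrite lee_fin mulr_ge0.
move=> _; apply: le_intRn => y; first by rewrite lee_fin mulr_ge0.
by rewrite lee_fin ler_pM.
Qed.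

Theorem theorem2 (R : realType) (n : nat) (alpha : R) :
  0 < alpha < n%:R ->
  (forall f : 'rV[R]_n -> R,
     log_concave f ->
     (intRn (fun x => (`|f x| ^+ 2)%:E) < +oo)%E ->
     (mid_H alpha f <= lhs_H alpha f)%E /\ (rhs_H alpha f <= mid_H alpha f)%E) /\
  (forall (a : R) (x0 : 'rV[R]_n) (V : 'M[R]_n),
     0 <= a -> \det V != 0 ->
     let f := fun x => a * fine (expeR (- gauge (simplex V) (x - x0))) in
     lhs_H alpha f = mid_H alpha f).
Proof.
case: n => [|m] /andP[al0 al_lt]; first by rewrite ltNge ltW in al_lt.
split=> [f /log_concave_logc lf f2|a x0 V a0 Vdet f]; last first.
  have Vu : V \in unitmx by rewrite unitmxE unitfE.
  apply: (mid_eq_lhs_Bor al0 al_lt (simplex_fun_ge0 x0 a0 Vu) (Bor_simplex_fun a x0 Vu)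
    (psi := simplex_norm V)).
  - by move=> x; apply: sumr_ge0.
  - move=> t x t0; rewrite /simplex_norm mulr_sumr; apply: eq_bigr => i _.
    by rewrite -scalemxAl mxE normrM gtr0_norm.
  - by move=> x; rewrite -corr_simplex.
have f0 := lf.1.
have {}f2 : (intRn (fun x => (f x ^+ 2)%:E) < +oo)%E.
  by apply: le_lt_trans f2; apply: le_intRn => x; rewrite lee_fin ?sqr_ge0// ger0_norm.
have [g [lg Bg gf fgq gbox]] := regularization lf f2.
have g0 := lg.1.
have goo : (corr g 0 < +oo)%E.
  rewrite corr0; apply: le_lt_trans f2; apply: le_intRn => x.
    by rewrite lee_fin sqr_ge0.
  by rewrite lee_fin lerXn2r ?nnegrE.
have LE q : 0 < q -> Lpn f q = Lpn g q by move=> /fgq; exact: eq_Lpn.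
have midE : mid_H alpha f = mid_H alpha g by rewrite /mid_H !LE.
have rhsE : rhs_H alpha f = rhs_H alpha g.
  have p0 : 0 < 2 * m.+1%:R / (m.+1%:R + alpha) by rewrite divr_gt0 ?mulr_gt0 ?addr_gt0.
  by rewrite /rhs_H (LE _ p0).
(* Replacing [f] by [g] preserves the middle and right-hand terms and can only decrease the
   left-hand one, so both inequalities follow from those for [g]. *)
rewrite midE rhsE; split; last exact: (rhs_H_le_mid al0 al_lt Bg g0 goo gbox).
apply: le_trans (le_lhs_H al0 g0 gf).
exact: (mid_le_lhs_Bor al0 al_lt g0 Bg goo lg.2).
Qed.
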